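(* Let $A\ge 0$ and $B>0$ be (possibly dependent) random variables with $p_0:=\mathbb{P}\{A=0\}\in(0,1)$. Let $D_n=A_nD_{n-1}+B_n$, $n\ge1$, where $(A_k,B_k)$ are independent copies of $(A,B)$ and $D_0$ is independent of them; let $D_\infty=\sum_{k=1}^\infty A_1\cdots A_{k-1}B_k$. Let $H$ be the distribution of $\log(1+A+B)$. (i) If $H$ is long-tailed and $D_0>0$, then $$\mathbb{P}\{D_n>x\}\ \ge\ \Bigl(\frac{1-(1-p_0)^n}{p_0}+o(1)\Bigr)\overline H(\log x)$$ as $x\to\infty$ uniformly for all $n\ge1$. In particular, $$\mathbb{P}\{D_\infty>x\}\ \ge\ (p_0^{-1}+o(1))\,\overline H(\log x)\quad\text{as }x\to\infty.$$ (ii) If $H$ is subexponential, $D_0>0$ and $\mathbb{P}\{D_0>x\}=o(\overline H(x))$ as $x\to\infty$, then $$\mathbb{P}\{D_n>x\}\ \sim\ \frac{1-(1-p_0)^n}{p_0}\,\overline H(\log x)$$ as $x\to\infty$ uniformly for all $n\ge1$. In particular, $$\mathbb{P}\{D_\infty>x\}\ \sim\ p_0^{-1}\,\overline H(\log x)\quad\text{as }x\to\infty.$$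
   Context: For a distribution $H$ on $\mathbb{R}$, $\overline H(x)=H(x,\infty)$ is its tail. A distribution $H$ with right-unbounded support is long-tailed if $\overline H(x+y)\sim\overline H(x)$ as $x\to\infty$ for each fixed $y$. A distribution $H$ on $[0,\infty)$ with unbounded support is subexponential if $\overline{H*H}(x)\sim 2\overline H(x)$ as $x\to\infty$. Standing assumption of the paper: $\mathbb{E}\log|A|=-a<0$, where $a=\infty$ is allowed (with $\log 0=-\infty$; here $\mathbb{P}\{A=0\}>0$, so $a=\infty$). The empty product $A_1\cdots A_{k-1}$ for $k=1$ equals $1$. Since $\mathbb{P}\{A=0\}>0$, the series defining $D_\infty$ has almost surely finitely many non-zero terms; its law is the stationary distribution of the Markov chain $D_n$. *)

(* Defs.v *)
From HB Require Import structures.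
From mathcomp Require Export all_boot all_order all_algebra.
From mathcomp Require Export finmap.
From mathcomp Require Export all_classical all_reals all_analysis.
From mathcomp Require Export measurable_realfun.

Set Implicit Arguments.
Unset Strict Implicit.
Unset Printing Implicit Defensive.

Import Order.TTheory GRing.Theory Num.Theory.
Import numFieldNormedType.Exports.

Local Open Scope classical_set_scope.
Local Open Scope ring_scope.

Definition tail (R : realType) (mu : set R -> \bar R) (x : R) : R :=
  fine (mu `]x, +oo[%classic).

Definition convolution (R : realType) (H1 H2 : probability R R)
    : set R -> \bar R :=
  pushforward (H1 \x H2)%E (fun z : R * R => z.1 + z.2).

(* Positivity of the tail says that the support is unbounded to the right; it
   also keeps the quotients away from division by zero. *)
Definition long_tailed (R : realType) (H : probability R R) : Prop :=
  (forall x, 0 < tail H x) /\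
  (forall y : R, tail H (x + y) / tail H x @[x --> +oo] --> (1 : R)).

Definition subexponential (R : realType) (H : probability R R) : Prop :=
  [/\ H `]-oo, 0[%classic = 0%E,
      (forall x, 0 < tail H x) &
      tail (convolution H H) x / (2 * tail H x) @[x --> +oo] --> (1 : R)].

Section independence.
Context (d : measure_display) (T : measurableType d) (R : realType).
Variable P : probability T R.

Definition mutually_independent (I : choiceType) (F : I -> set (set T)) : Prop :=
  forall (J : {fset I}) (E : I -> set T),
    (forall i, i \in J -> F i (E i)) ->
    P (\bigcap_(i in [set` J]) E i) = (\prod_(i <- J) P (E i))%E.

Definition sigma_of d' (T' : measurableType d') (X : T -> T') : set (set T) :=
  preimage_set_system setT X measurable.

End independence.

Section affine_recursion.
Context (d : measure_display) (T : measurableType d) (R : realType).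

(* The sequence of coefficients is indexed from 0: [(A k, B k)] is the pair
   (A_{k+1}, B_{k+1}), so that D_{n+1} = A_{n+1} D_n + B_{n+1}. *)
Fixpoint chain (A B : nat -> T -> R) (D0 : T -> R) (n : nat) (w : T) : R :=
  if n is m.+1 then A m w * chain A B D0 m w + B m w else D0 w.

(* Extended-real valued, because the series is only almost surely finite; the
   k-th term (k >= 0) is A_1 ... A_k B_{k+1}. *)
Definition perpetuity (A B : nat -> T -> R) (w : T) : \bar R :=
  (\sum_(0 <= k <oo) ((\prod_(i < k) A i w) * B k w)%:E)%E.

(* The elements with index [None] and [Some k] are the sigma-algebras generated
   by D_0 and by the pair (A_{k+1}, B_{k+1}). *)
Definition driving_sigma (A B : nat -> T -> R) (D0 : T -> R) (i : option nat)
    : set (set T) :=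
  if i is Some k then sigma_of (fun w => (A k w, B k w)) else sigma_of D0.

End affine_recursion.

Definition log1pD (T : Type) (R : realType) (A B : T -> R) (w : T) : R :=
  ln (1 + A w + B w).

Section log1pD_measurable.
Context (d : measure_display) (T : measurableType d) (R : realType).
Variables A B : {mfun T >-> R}.

Let measurable_log1pD : measurable_fun [set: T] (log1pD A B).
Proof.
apply: measurableT_comp; first exact: measurable_ln.
by apply: measurable_funD => //; apply: measurable_funD.
Qed.

HB.instance Definition _ :=
  isMeasurableFun.Build _ _ _ _ (log1pD A B) measurable_log1pD.

End log1pD_measurable.

(* E log|X| exists in [-oo, 0), with log 0 = -oo.  The first clause makes the
   integral meaningful: without it, [\int] evaluates oo - oo to -oo. *)
Definition negative_log_mean (d : measure_display) (T : measurableType d)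
    (R : realType) (P : probability T R) (X : T -> R) : Prop :=
  let logX := fun w => lne (`|X w|%:E) in
  (\int[P]_w (logX^\+ w) < +oo)%E /\ (\int[P]_w logX w < 0)%E.

(* Main.v *)
Require Import Defs.
From HB Require Import structures.
From mathcomp Require Import ring lra.

(* Put h for the tail of H and q = 1 - p0, so that the constants c_n satisfy
   c_0 = 0 and c_{n+1} = 1 + q c_n; both bounds are proved by induction along
   X -> A X + B with X independent of (A, B), uniformly in n.

   Lower bound: A X + B exceeds x when X > delta and A + B > x / delta, and,
   disjointly, when X > K x, A > 1 / K and A + B <= x / delta.  Long-tailedness
   absorbs the factors delta and K, which gives P(AX + B > x) >= (1 - eta) h(log x)
   + (q - eta) P(X > K x).  The threshold only moves up, so one x_0 serves all n.

   Upper bound: 1 + A X + B <= (1 + A + B)(1 + X).  With xi = log(1 + A + B),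
   the event log(1 + A X + B) > t forces xi > t - L, or A <> 0 and
   log(1 + X) > t - L, or both summands are above L.  Subexponentiality bounds
   the last event once the tail of log(1 + X) is at most K h.  This first yields
   a constant K valid for all n and t; m further iterations replace it by
   c_n + e + K q^m.

   The n-th partial sum of the perpetuity is the composition of the same affine
   maps in reversed order, hence obeys the same recursion in law. *)

Import Order.TTheory GRing.Theory Num.Theory.
Import numFieldNormedType.Exports.

Set Implicit Arguments.
Unset Strict Implicit.
Unset Printing Implicit Defensive.

Local Open Scope classical_set_scope.
Local Open Scope ring_scope.

(** * Real-valued probabilities and almost sure comparison of events *)

Section probability_of_sets.
Context (d : measure_display) (T : measurableType d) (R : realType).
Variable P : probability T R.
Implicit Types S : set T.

(** Real-valued, so that the estimates below become goals for [lra] and [nra]. *)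
Definition pr S : R := fine (P S).

Lemma prE S : measurable S -> (pr S)%:E = P S.
Proof. by move=> mS; rewrite /pr fineK// fin_num_measure. Qed.

Lemma pr_ge0 S : 0 <= pr S.
Proof. by rewrite /pr fine_ge0// measure_ge0. Qed.

Lemma pr_le1 S : measurable S -> pr S <= 1.
Proof. by move=> mS; rewrite -lee_fin prE// probability_le1. Qed.

Lemma pr_setT : pr setT = 1.
Proof. by rewrite /pr probability_setT. Qed.

Lemma pr_ae_le S S' : measurable S -> measurable S' ->
  {ae P, forall w, S w -> S' w} -> pr S <= pr S'.
Proof.
move=> mS mS' [N [mN PN0 SN]].
rewrite -lee_fin !prE//.
have -> : P S' = (P S' + P N)%E by rewrite PN0 adde0.
apply: (@le_trans _ _ (P (S' `|` N))); last exact: measureU2.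
apply: le_measure; rewrite ?inE//; first exact: measurableU.
move=> w Sw; have [S'w|nS'w] := pselect (S' w); [by left|right].
by apply: SN => /= /(_ Sw).
Qed.

Lemma pr_le S S' : measurable S -> measurable S' -> S `<=` S' -> pr S <= pr S'.
Proof. by move=> mS mS' SS'; apply: pr_ae_le => //; exact: aeW. Qed.

Lemma pr_ae_eq S S' : measurable S -> measurable S' ->
  {ae P, forall w, S w <-> S' w} -> pr S = pr S'.
Proof.
move=> mS mS' SS'; apply/eqP; rewrite eq_le.
by rewrite !pr_ae_le//; apply: filterS SS' => w [].
Qed.

Lemma prU_le S S' : measurable S -> measurable S' ->
  pr (S `|` S') <= pr S + pr S'.
Proof.
move=> mS mS'; rewrite -lee_fin EFinD !prE//; last exact: measurableU.
exact: measureU2.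
Qed.

Lemma prU S S' : measurable S -> measurable S' -> S `&` S' = set0 ->
  pr (S `|` S') = pr S + pr S'.
Proof.
move=> mS mS' SS'; apply: EFin_inj; rewrite EFinD !prE//; last exact: measurableU.
exact: measureU.
Qed.

Lemma prC S : measurable S -> pr (~` S) = 1 - pr S.
Proof.
move=> mS; rewrite -pr_setT -(setvU S) prU//; last by rewrite setICl.
  by rewrite addrK.
exact: measurableC.
Qed.

Lemma prI_ge S S' : measurable S -> measurable S' ->
  pr S - pr (~` S') <= pr (S `&` S').
Proof.
move=> mS mS'; rewrite lerBlDr -prU//; first last.
- by rewrite -setIA setICr setI0.
- exact: measurableC.
- exact: measurableI.
apply: pr_le => //; first by apply: measurableU; [exact: measurableI|exact: measurableC].
by move=> w Sw; have [|] := pselect (S' w); [left|right].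
Qed.

Lemma pr_ae1 S : measurable S -> {ae P, forall w, S w} -> pr S = 1.
Proof.
by move=> mS aeS; rewrite -pr_setT; apply: pr_ae_eq => //; apply: filterS aeS.
Qed.

Lemma ae_pr1 S : measurable S -> pr S = 1 -> {ae P, forall w, S w}.
Proof.
move=> mS PS1; exists (~` S); split; [exact: measurableC| |by []].
by rewrite -prE; [rewrite prC// PS1 subrr|exact: measurableC].
Qed.

End probability_of_sets.

Lemma measurable_gtr d (T : measurableType d) (R : realType) (f g : T -> R) :
  measurable_fun setT f -> measurable_fun setT g ->
  measurable [set w | f w < g w].
Proof.
move=> mf mg; have := measurable_fun_ltr mf mg measurableT.
move=> /(_ [set true]); rewrite setTI; exact.
Qed.

Lemma measurable_ger d (T : measurableType d) (R : realType) (f g : T -> R) :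
  measurable_fun setT f -> measurable_fun setT g ->
  measurable [set w | f w <= g w].
Proof.
move=> mf mg; have := measurable_fun_ler mf mg measurableT.
move=> /(_ [set true]); rewrite setTI; exact.
Qed.

Lemma measurable_eqr d (T : measurableType d) (R : realType) (f g : T -> R) :
  measurable_fun setT f -> measurable_fun setT g ->
  measurable [set w | f w = g w].
Proof.
move=> mf mg; rewrite (_ : [set _ | _] = [set w | f w <= g w] `&` [set w | g w <= f w]).
  by apply: measurableI; exact: measurable_ger.
by apply/seteqP; split=> w /= => [->|[? ?]]; [rewrite lexx|apply/le_anti/andP].
Qed.

Section product_law.
Context d1 d2 (T1 : measurableType d1) (T2 : measurableType d2) (R : realType).
Variables (P1 : probability T1 R) (P2 : probability T2 R).

(** A separate name for the product measure, on which a probability structure can be declared. *)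
Definition product_law : set (T1 * T2) -> \bar R := (P1 \x P2)%E.

HB.instance Definition _ := Measure.on product_law.

Let product_law_setT : product_law setT = 1%E.
Proof.
rewrite -setXTT; transitivity (P1 setT * P2 setT)%E; first exact: product_measure1E.
by rewrite !probability_setT mule1.
Qed.

HB.instance Definition _ :=
  Measure_isProbability.Build _ _ _ product_law product_law_setT.

Lemma pr_rectangle U V : measurable U -> measurable V ->
  pr product_law (U `*` V) = pr P1 U * pr P2 V.
Proof.
move=> mU mV; apply: EFin_inj; rewrite EFinM !prE//; last exact: measurableX.
exact: product_measure1E.
Qed.

End product_law.

(** * Limits at infinity and continuity of tails *)

Lemma near_pinftyP (R : realType) (Q : R -> Prop) :
  (\forall x \near +oo, Q x) <-> exists M, forall x, M <= x -> Q x.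
Proof.
split=> [[M [_ MQ]]|[M MQ]].
  (* The filter at infinity supplies a strict lower bound; the shift by 1 makes it non-strict. *)
  by exists (M + 1) => x Mx; apply: MQ; rewrite (lt_le_trans _ Mx)// ltrDl.
by exists M; split; [exact: num_real|move=> x /ltW; exact: MQ].
Qed.

Lemma cvgr_pinfty_dist (R : realType) (f : R -> R) (l : R) :
  f x @[x --> +oo] --> l <->
  forall e, 0 < e -> exists M, forall x, M <= x -> `|f x - l| <= e.
Proof.
split=> [fl e e0|fl].
  apply/near_pinftyP; move/cvgrPdist_le : fl => /(_ _ e0).
  by apply: filterS => x; rewrite distrC.
apply/cvgrPdist_le => e e0; apply/near_pinftyP.
by have [M fM] := fl _ e0; exists M => x Mx; rewrite distrC fM.
Qed.

Section tail.
Context (R : realType) (H : probability R R).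
Local Notation h := (tail H).

Lemma measurable_gt (x : R) : measurable [set y : R | x < y].
Proof. by rewrite -set_itvoy; exact: measurable_itv. Qed.

Lemma tailE x : h x = pr H [set y | x < y].
Proof. by rewrite /tail set_itvoy. Qed.

Lemma tail_ge0 x : 0 <= h x. Proof. by rewrite tailE pr_ge0. Qed.

Lemma tail_anti x y : x <= y -> h y <= h x.
Proof.
move=> xy; rewrite !tailE; apply: pr_le; try exact: measurable_gt.
by move=> z /=; exact: le_lt_trans.
Qed.

(** Continuity from above along the half-lines (n, oo), whose intersection is empty; monotonicity
    then covers real thresholds. *)
Lemma tail_cvg0 e : 0 < e -> exists M, forall x, M <= x -> h x <= e.
Proof.
move=> e0.
pose F n := [set y : R | n%:R < y].
have mF n : measurable (F n) by exact: measurable_gt.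
have F0 : \bigcap_n F n = set0.
  apply/seteqP; split=> // y /(_ (Num.truncn y).+1 I) /=.
  by move=> ylt; have := lt_trans (truncnS_gt y) ylt; rewrite ltxx.
have : H \o F @ \oo --> H (\bigcap_n F n).
  apply: nonincreasing_cvg_mu => //; first by rewrite ltey_eq fin_num_measure.
    by rewrite F0.
  move=> m n mn; apply/subsetPset => y /=; apply: le_lt_trans.
  by rewrite ler_nat.
rewrite F0 measure0 => /fine_cvgP[_] /cvgrPdist_le/(_ _ e0)[N _ /(_ N (leqnn N))] /= hN.
exists N%:R => x /tail_anti/le_trans; apply; apply: le_trans hN.
by rewrite sub0r normrN tailE ler_norm.
Qed.

End tail.

(** Continuity from below along the thresholds 1/(n+1). It replaces positivity of A, B or D_0 by a
    fixed gap above 0, at the cost of e. *)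
Lemma pr_gt0_approx d (T : measurableType d) (R : realType)
    (P : probability T R) (f : T -> R) (e : R) :
  measurable_fun setT f -> 0 < e ->
  exists2 c, 0 < c <= 1 & pr P [set w | 0 < f w] - e <= pr P [set w | c < f w].
Proof.
move=> mf e0; pose F n := [set w | n.+1%:R^-1 < f w].
have mF n : measurable (F n) by exact: measurable_gtr.
have FE : \bigcup_n F n = [set w | 0 < f w].
  apply/seteqP; split=> w /=.
    by move=> [n _] /=; apply: lt_trans; rewrite invr_gt0 ltr0n.
  move=> fw0; exists (Num.truncn (f w)^-1) => //=.
  by rewrite /F/= invf_plt ?posrE ?ltr0n// truncnS_gt.
have : P \o F @ \oo --> P (\bigcup_n F n).
  apply: nondecreasing_cvg_mu => //; first exact: bigcup_measurable.
  move=> m n mn; apply/subsetPset => w /=; apply: le_lt_trans.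
  by rewrite lef_pV2 ?posrE ?ltr0n// ler_nat ltnS.
rewrite FE -prE; last exact: measurable_gtr.
move=> /fine_cvgP[_] /cvgrPdist_le/(_ _ e0)[N _ /(_ N (leqnn N))] /= hN.
exists N.+1%:R^-1; first by rewrite invr_gt0 ltr0n/= invf_le1 ?ltr0n// ler1n.
by rewrite lerBlDl -lerBlDr; apply: le_trans hN; rewrite ler_norm.
Qed.

(** * Subexponential laws: shifts and two large summands *)

Section subexponential.
Context (R : realType) (H : probability R R).
Local Notation h := (tail H).
Local Notation HH := (product_law H H).

Let measurable_sum_gt t : measurable [set z : R * R | t < z.1 + z.2].
Proof.
apply: measurable_gtr; first exact: measurable_cst.
by apply: measurable_funD; [exact: measurable_fst|exact: measurable_snd].
Qed.

Hypothesis subH : subexponential H.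

Let h_gt0 x : 0 < h x. Proof. by case: subH. Qed.

Let sum_tail_le e : 0 < e -> exists M, forall t, M <= t ->
  pr HH [set z | t < z.1 + z.2] <= (2 + e) * h t.
Proof.
case: subH => _ _ /cvgr_pinfty_dist + e0.
have e20 : 0 < e / 2 by rewrite divr_gt0.
move=> /(_ _ e20)[M hM]; exists M => t /hM; have ht0 := h_gt0 t.
have -> : tail (convolution H H) t = pr HH [set z | t < z.1 + z.2].
  by rewrite /tail /convolution /pushforward set_itvoy.
rewrite ler_distl => /andP[_].
rewrite ler_pdivrMr ?mulr_gt0// => /le_trans; apply.
by rewrite le_eqVlt; apply/orP; left; apply/eqP; field.
Qed.

Let pr_ge0_half : pr H [set s | 0 <= s] = 1.
Proof.
have -> : [set s : R | 0 <= s] = ~` `]-oo, 0[%classic.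
  by rewrite setCitvl set_itvcy.
rewrite prC; last exact: measurable_itv.
by case: subH => + _ _; rewrite /pr => ->; rewrite subr0.
Qed.

Let measurable_cc (a b : R) : measurable [set s : R | a <= s <= b].
Proof. by have := @measurable_itv R `[a, b]; rewrite set_itvcc. Qed.

Let measurable_oc (a b : R) : measurable [set s : R | a < s <= b].
Proof. by have := @measurable_itv R `]a, b]; rewrite set_itvoc. Qed.

Let measurable_ge0 : measurable [set s : R | 0 <= s].
Proof. by have := @measurable_itv R `[0, +oo[; rewrite set_itvcy. Qed.

Let pr_cc L : pr H [set s | 0 <= s <= L] = 1 - h L.
Proof.
rewrite tailE -prC; last exact: measurable_gt.
apply: pr_ae_eq => //; first by apply: measurableC; exact: measurable_gt.
have := ae_pr1 measurable_ge0 pr_ge0_half; apply: filterS => s /= s0.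
by rewrite s0 /=; split => [sL|/negP]; [apply/negP|]; rewrite -leNgt.
Qed.

Let pr_oc a b : a <= b -> pr H [set s | a < s <= b] = h a - h b.
Proof.
move=> ab; apply/eqP; rewrite -subr_eq opprK eq_sym !tailE; apply/eqP.
rewrite -prU//; [|exact: measurable_gt|].
  congr pr; apply/seteqP; split=> s /=.
    by move=> as_; case: (leP s b) => sb; [left; rewrite as_|right].
  by case=> [/andP[]//|]; exact: le_lt_trans.
by apply/seteqP; split=> s //= [/andP[? ?] ?]; lra.
Qed.

(** The event that the sum exceeds t contains the disjoint rectangles (t, oo) x [0, oo), [0, y] x
    (t, oo) and (y, t] x (t - y, oo). Their total mass is at most about 2 h(t), and the first two
    take (2 - h(y)) h(t). So (h(y) - h(t)) h(t - y) is at most about h(y) h(t), where h(t) is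
    negligible against h(y). *)
Lemma subexponential_shift y e : 0 <= y -> 0 < e ->
  exists M, forall t, M <= t -> h (t - y) <= (1 + e) * h t.
Proof.
move=> y0 e0; have hy0 := h_gt0 y.
(* Both tolerances are proportional to h(y), because the last step divides by h(y) - h(t). *)
have e10 : 0 < e * h y / 4 by rewrite divr_gt0// mulr_gt0.
have e20 : 0 < e * h y / (4 * (1 + e)).
  by rewrite divr_gt0// ?mulr_gt0// addr_gt0.
have [M1 hM1] := sum_tail_le e10.
have [M2 hM2] := tail_cvg0 H e20.
exists (Num.max y (Num.max M1 M2)) => t; rewrite !ge_max => /and3P[yt M1t M2t].
have := hM1 _ M1t; have := hM2 _ M2t; have ht0 := h_gt0 t.
have : h t * 1 + ((1 - h y) * h t + (h y - h t) * h (t - y)) <=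
    pr HH [set z | t < z.1 + z.2].
  rewrite -pr_cc -(pr_oc yt) -pr_ge0_half !tailE -!pr_rectangle//; try exact: measurable_gt.
  rewrite -!prU//; first last.
  - by apply/seteqP; split=> -[a b] //= [[/andP[a0 ay] _] [/andP[ya _] _]]; lra.
  - apply: measurableX => //; exact: measurable_gt.
  - apply: measurableX => //; exact: measurable_gt.
  - by apply/seteqP; split=> -[a b] //= [[ta b0] [[/andP[a0 ay] ?]|[/andP[ya aT] ?]]]; lra.
  - apply: measurableU; apply: measurableX => //; exact: measurable_gt.
  - apply: measurableX => //; exact: measurable_gt.
  apply: pr_le => //.
    apply: measurableU; first by apply: measurableX => //; exact: measurable_gt.
    apply: measurableU; apply: measurableX => //; exact: measurable_gt.
  move=> [a b] [|[]] [/=] => [|/andP[]|/andP[]]; lra.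
move: (h (t - y)) (h t) (h y) ht0 hy0 {e10 e20 hM1 hM2} => u v w v0 w0 A1 A2 A3.
have {}A2 : v * (4 * (1 + e)) <= e * w.
  by rewrite -ler_pdivlMr// mulr_gt0// addr_gt0.
have {A1 A3} : (w - v) * u <= (w + e * w / 4) * v by lra.
have wv : 0 < w - v by nra.
move=> le1; rewrite -(ler_pM2l wv); apply: le_trans le1 _.
rewrite mulrA ler_wpM2r//; first exact: ltW.
nra.
Qed.

Lemma subexponential_long_tailed : long_tailed H.
Proof.
split=> // y; apply/cvgr_pinfty_dist => e e0.
have [M hM] := subexponential_shift (normr_ge0 y) e0.
exists (M + `|y|) => t Mt.
have ht0 := h_gt0 t; have hty0 := h_gt0 (t + y).
rewrite ler_distl ler_pdivlMr// ler_pdivrMr//.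
have := ler_norm y; have := ler_norm (- y); rewrite normrN => yn ny.
have y0 := normr_ge0 y; have Mt' : M <= t by lra.
have h1 := hM t Mt'.
apply/andP; split.
  have My : M <= t + y by lra.
  have : h t <= (1 + e) * h (t + y).
    by apply: le_trans (hM _ My); apply: tail_anti; lra.
  have : h t * e >= 0 by rewrite mulr_ge0 ?ltW.
  (* For e >= 1 the lower bound is nonpositive; otherwise (1 - e)(1 + e) <= 1 applies. *)
  have [e1|e1] := leP 1 e; nra.
by apply: le_trans h1; apply: tail_anti; lra.
Qed.

(** The rectangles with one summand in [0, L] and the other above t, disjoint once t >= L, have mass
    2 (1 - h(L)) h(t) out of at most (2 + e/2) h(t). With h(L) <= e/4 at most e h(t) remains. *)
Lemma subexponential_two_large e : 0 < e -> exists L M, 0 <= L /\ forall t, M <= t ->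
  pr HH [set z | [/\ L < z.1, L < z.2 & t < z.1 + z.2]] <= e * h t.
Proof.
move=> e0; have e20 : 0 < e / 2 by rewrite divr_gt0.
have e40 : 0 < e / 4 by rewrite divr_gt0.
have [L0 hL0] := tail_cvg0 H e40; have [M0 hM0] := sum_tail_le e20.
pose L := Num.max 0 L0; exists L, (Num.max L M0); split; first by rewrite le_max lexx.
move=> t; rewrite ge_max => /andP[Lt /hM0 M0t].
have {}hL0 : h L <= e / 4 by apply: hL0; rewrite le_max lexx orbT.
clearbody L.
set W := [set z | _]; have mW : measurable W.
  rewrite (_ : W = ([set s | L < s] `*` [set s | L < s]) `&` [set z | t < z.1 + z.2]).
    by apply: measurableI => //; apply: measurableX; exact: measurable_gt.
  by apply/seteqP; split=> z /= [] => [? ? ?|[? ?] ?].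
have ht0 := h_gt0 t.
suff : (1 - h L) * h t + (h t * (1 - h L) + pr HH W) <= pr HH [set z | t < z.1 + z.2].
  nra.
rewrite -pr_cc !tailE -!pr_rectangle//; try exact: measurable_gt.
rewrite -!prU//; first last.
- by apply/seteqP; split=> -[a b] //= [[ta /andP[b0 bL]] [? ? ?]]; simpl in *; lra.
- apply: measurableX => //; exact: measurable_gt.
- apply/seteqP; split=> -[a b] //= [[/andP[a0 aL] tb] [[ta /andP[b0 bL]]|[? ? ?]]];
  by simpl in *; lra.
- apply: measurableU => //; apply: measurableX => //; exact: measurable_gt.
- apply: measurableX => //; exact: measurable_gt.
apply: pr_le => //.
  apply: measurableU; first by apply: measurableX => //; exact: measurable_gt.
  by apply: measurableU => //; apply: measurableX => //; exact: measurable_gt.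
by move=> [a b] [|[]] [/=] => [/andP[]||]; simpl in *; lra.
Qed.

End subexponential.

(** * Independence extended from rectangles to all measurable sets *)

Section rectangles.
Context d1 d2 (T1 : measurableType d1) (T2 : measurableType d2) (R : realType).

(** Rectangles generate the product sigma-algebra and are stable under intersection; the whole space
    is itself a rectangle, so a constant sequence exhausts it. *)
Lemma rectangle_measure_unique (m1 m2 : {measure set (T1 * T2) -> \bar R}) :
  (m1 setT < +oo)%E ->
  (forall U V, measurable U -> measurable V -> m1 (U `*` V) = m2 (U `*` V)) ->
  forall W, measurable W -> m1 W = m2 W.
Proof.
move=> m1oo m12 W mW.
pose C := [set A1 `*` A2 | A1 in @measurable _ T1 & A2 in @measurable _ T2].
apply: (measure_unique C (fun=> setT)) => //.
- exact: measurable_prod_measurableType.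
- move=> _ _ [X1 mX1 [X2 mX2 <-]] [Y1 mY1 [Y2 mY2 <-]].
  rewrite -setXI; exists (X1 `&` Y1); first exact: measurableI.
  by exists (X2 `&` Y2) => //; exact: measurableI.
- by move=> _; exists setT => //; exists setT => //; rewrite setXTT.
- by rewrite bigcup_const//; exists 0%N.
- by move=> _ [X mX [Y mY <-]]; exact: m12.
Qed.

End rectangles.

Lemma measurable_funT_preimage d1 d2 (T1 : measurableType d1)
    (T2 : measurableType d2) (f : T1 -> T2) (V : set T2) :
  measurable_fun setT f -> measurable V -> measurable (f @^-1` V).
Proof. by move=> mf mV; rewrite -[X in measurable X]setTI; exact: mf. Qed.

Section independence_on_rectangles.
Context (d : measure_display) (T : measurableType d) (R : realType).
Variable P : probability T R.
Context d1 d2 (T1 : measurableType d1) (T2 : measurableType d2).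
Variables (X : T -> T1) (Y : T -> T2).
Hypotheses (mX : measurable_fun setT X) (mY : measurable_fun setT Y).

Let XY w := (X w, Y w).
Let mXY : measurable_fun setT XY. Proof. exact: measurable_fun_pair. Qed.

(** As functions of W both sides are measures: the law of (X, Y) under P restricted to G, and the
    law of (X, Y) scaled by P(G). Uniqueness on rectangles applies. This is what carries
    independence through the affine map. *)
Lemma pr_pair_setI (G : set T) : measurable G ->
  (forall U V, measurable U -> measurable V ->
    pr P (X @^-1` U `&` Y @^-1` V `&` G) = pr P (X @^-1` U `&` Y @^-1` V) * pr P G) ->
  forall W, measurable W -> pr P (XY @^-1` W `&` G) = pr P (XY @^-1` W) * pr P G.
Proof.
move=> mG rect W mW.
pose F : {mfun T >-> (T1 * T2)%type} := HB.pack XY (isMeasurableFun.Build _ _ _ _ XY mXY).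
pose m1 := mscale (NngNum (pr_ge0 P G)) (distribution P F).
pose m2 := measure_function_pushforward__canonical__measure_function_Measure
  (mrestr P mG) mXY.
suff : m1 W = m2 W.
  rewrite /m1 /m2 /= /mscale/= /distribution /pushforward /mrestr/= => m12.
  apply: EFin_inj; rewrite mulrC EFinM.
  rewrite !prE//; first by rewrite -m12 prE.
  - exact: measurable_funT_preimage.
  - by apply: measurableI => //; exact: measurable_funT_preimage.
apply: rectangle_measure_unique => //.
  by rewrite /m1/= /mscale/= probability_setT mule1 ltry.
move=> U V mU mV.
rewrite /m1 /m2 /= /mscale/= /distribution /pushforward /mrestr/=.
have -> : XY @^-1` (U `*` V) = X @^-1` U `&` Y @^-1` V by [].
have mUV : measurable (X @^-1` U `&` Y @^-1` V).
  by apply: measurableI; exact: measurable_funT_preimage.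
by rewrite -!prE//; [rewrite rect// mulrC EFinM|exact: measurableI].
Qed.

Lemma pr_pair_product (FX : {mfun T >-> T1}) (FY : {mfun T >-> T2}) :
  FX =1 X -> FY =1 Y ->
  (forall U V, measurable U -> measurable V ->
    pr P (X @^-1` U `&` Y @^-1` V) = pr P (X @^-1` U) * pr P (Y @^-1` V)) ->
  forall W, measurable W ->
    pr P (XY @^-1` W) = pr (product_law (distribution P FX) (distribution P FY)) W.
Proof.
move=> /funext FXE /funext FYE rect W mW.
pose F : {mfun T >-> (T1 * T2)%type} := HB.pack XY (isMeasurableFun.Build _ _ _ _ XY mXY).
transitivity (pr (distribution P F) W) => //.
apply: EFin_inj; rewrite !prE//.
apply: rectangle_measure_unique => //.
  by rewrite /= probability_setT ltry.
move=> U V mU mV; have mUV := measurableX mU mV.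
have mXU := measurable_funT_preimage mX mU.
have mYV := measurable_funT_preimage mY mV.
rewrite -[RHS]prE// pr_rectangle//.
have -> : pr (distribution P FX) U = pr P (X @^-1` U).
  by rewrite /pr -FXE.
have -> : pr (distribution P FY) V = pr P (Y @^-1` V).
  by rewrite /pr -FYE.
by rewrite -rect// prE//; exact: measurableI.
Qed.

End independence_on_rectangles.

(** * One affine step: lower and upper tail bounds *)

Section affine_step.
Context (R : realType) (d0 : measure_display) (T0 : measurableType d0).
Variables (P0 : probability T0 R) (A B : {RV P0 >-> R}).
Hypotheses (A_ge0 : {ae P0, forall w, 0 <= A w}) (B_gt0 : {ae P0, forall w, 0 < B w}).
Context (d : measure_display) (T : measurableType d) (P : probability T R).

Local Notation H := (distribution P0 (log1pD A B)).
Local Notation h := (tail H).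
Local Notation p0 := (pmf A 0).

(** The data of one step: (A', B') is a copy of (A, B), with dependence inside the pair allowed, and
    is independent of X. The copy lives on its own space [T]. *)
Record affine_input (A' B' X : T -> R) : Prop := AffineInput {
  input_measurable1 : measurable_fun setT A';
  input_measurable2 : measurable_fun setT B';
  input_measurable : measurable_fun setT X;
  input_law : forall E : set (R * R), measurable E ->
    P [set w | E (A' w, B' w)] = P0 [set w | E (A w, B w)];
  input_indep : forall (U : set R) (W : set (R * R)), measurable U -> measurable W ->
    pr P (X @^-1` U `&` [set w | W (A' w, B' w)]) =
    pr P (X @^-1` U) * pr P [set w | W (A' w, B' w)] }.

Lemma measurable_log1p_add d1 (T1 : measurableType d1) (f g : T1 -> R) :
  measurable_fun setT f -> measurable_fun setT g ->
  measurable_fun setT (fun w => ln (1 + f w + g w)).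
Proof.
move=> mf mg; apply: measurableT_comp; first exact: measurable_ln.
by apply: measurable_funD => //; apply: measurable_funD.
Qed.

Variables (A' B' X : T -> R).
Hypothesis inp : affine_input A' B' X.

Let mA' : measurable_fun setT A'. Proof. by case: inp. Qed.
Let mB' : measurable_fun setT B'. Proof. by case: inp. Qed.
Let mX : measurable_fun setT X. Proof. by case: inp. Qed.
Let m1 : measurable_fun setT (fun z : R * R => z.1).
Proof. exact: measurable_fst. Qed.
Let m2 : measurable_fun setT (fun z : R * R => z.2).
Proof. exact: measurable_snd. Qed.
Let mc (c : R) : measurable_fun setT (fun _ : R * R => c).
Proof. exact: measurable_cst. Qed.

Let pr_law (E : set (R * R)) : measurable E ->
  pr P [set w | E (A' w, B' w)] = pr P0 [set w | E (A w, B w)].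
Proof. by move=> mE; rewrite /pr; case: inp => _ _ _ -> . Qed.

Let mpair : measurable_fun setT (fun w => (A' w, B' w)).
Proof. exact: measurable_fun_pair. Qed.

Let mpair0 : measurable_fun setT (fun w => (A w, B w)).
Proof. exact: measurable_fun_pair. Qed.

(** An almost sure property is an event of probability one, so equality of laws carries it over. *)
Let ae_law (E : set (R * R)) : measurable E ->
  {ae P0, forall w, E (A w, B w)} -> {ae P, forall w, E (A' w, B' w)}.
Proof.
move=> mE aeE; apply: ae_pr1; first exact: (measurable_funT_preimage mpair mE).
by rewrite pr_law//; apply: pr_ae1 => //; exact: (measurable_funT_preimage mpair0 mE).
Qed.

Lemma input_ge0 : {ae P, forall w, 0 <= A' w}.
Proof.
apply: (@ae_law [set z | 0 <= z.1]) => //; exact: measurable_ger.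
Qed.

Lemma input_gt0 : {ae P, forall w, 0 < B' w}.
Proof.
apply: (@ae_law [set z | 0 < z.2]) => //; exact: measurable_gtr.
Qed.

Lemma input_tail2 (x : R) : pr P [set w | x < B' w] = pr P0 [set w | x < B w].
Proof. by apply: (@pr_law [set z | x < z.2]); exact: measurable_gtr. Qed.

Lemma input_tail1 (x : R) : pr P [set w | x < A' w] = pr P0 [set w | x < A w].
Proof. by apply: (@pr_law [set z | x < z.1]); exact: measurable_gtr. Qed.

Let xi w := ln (1 + A' w + B' w).

Let mxi : measurable_fun setT xi. Proof. exact: measurable_log1p_add. Qed.

Let xi_law U : measurable U -> pr P (xi @^-1` U) = pr H U.
Proof.
move=> mU; apply: (@pr_law [set z | U (ln (1 + z.1 + z.2))]).
by apply: (measurable_funT_preimage _ mU); exact: measurable_log1p_add.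
Qed.

Let xi_tail u : pr P [set w | u < xi w] = h u.
Proof. by rewrite tailE -xi_law//; exact: measurable_gt. Qed.

(** The two events are separated by the position of log(1 + A + B) relative to ln(1 + x/delta).
    Hence their probabilities add, and the separation costs the second event at most the tail of H
    there. Independence turns each probability into a product. *)
Lemma affine_tail_ge (delta K x : R) : 0 < delta <= 1 -> 0 < K -> 0 <= x ->
  {ae P, forall w, 0 <= X w} ->
  pr P [set w | delta < X w] * h (ln (1 + x / delta)) +
  pr P [set w | x * K < X w] * (pr P0 [set w | K^-1 < A w] - h (ln (1 + x / delta)))
  <= pr P [set w | x < A' w * X w + B' w].
Proof.
move=> /andP[delta0 delta1] K0 x0 X0.
set v := ln _; pose W := [set z : R * R | v < ln (1 + z.1 + z.2)].
have mW : measurable W.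
  by apply: measurable_gtr => //; exact: measurable_log1p_add.
have mW' : measurable [set w | W (A' w, B' w)].
  exact: (measurable_funT_preimage mpair mW).
pose V := [set z : R * R | K^-1 < z.1] `&` ~` W.
have mV : measurable V.
  by apply: measurableI; [exact: measurable_gtr|exact: measurableC].
have mV' : measurable [set w | V (A' w, B' w)].
  exact: (measurable_funT_preimage mpair mV).
have VE : pr P0 [set w | K^-1 < A w] - h v <= pr P [set w | V (A' w, B' w)].
  rewrite -input_tail1 -xi_tail.
  have mxiv : measurable [set w | v < xi w] by exact: measurable_gtr.
  have mA'K : measurable [set w | K^-1 < A' w] by exact: measurable_gtr.
  have := prI_ge P mA'K (measurableC mxiv); rewrite setCK; exact.
have mX1 : measurable [set w | delta < X w] by exact: measurable_gtr.
have mX2 : measurable [set w | x * K < X w] by exact: measurable_gtr.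
apply: (@le_trans _ _ (pr P [set w | delta < X w] * pr P [set w | W (A' w, B' w)] +
    pr P [set w | x * K < X w] * pr P [set w | V (A' w, B' w)])).
  apply: lerD; last by apply: ler_wpM2l => //; exact: pr_ge0.
  by rewrite -xi_tail.
case: inp => _ _ _ _ ind.
rewrite -(ind [set y | delta < y])//; last exact: measurable_gt.
rewrite -(ind [set y | x * K < y])//; last exact: measurable_gt.
rewrite -prU//; first last.
- by apply/seteqP; split=> w //= [[_ Ww] [_ [_ /(_ Ww)]]].
- exact: measurableI.
- exact: measurableI.
apply: pr_ae_le; first by apply: measurableU; exact: measurableI.
  by apply: measurable_gtr => //; apply: measurable_funD => //; exact: measurable_funM.
have := input_ge0; have := input_gt0; move: X0.
apply: filterS3 => w /= Xw Bw Aw [[dX]|[xX [KA _]]].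
  rewrite /W/= /v ltr_ln ?posrE; first last.
  - by rewrite ltr_wpDl// addr_ge0.
  - by rewrite ltr_pwDl// divr_ge0// ltW.
  (* Here A X + B >= delta (A + B), because X > delta and delta <= 1. *)
  rewrite -addrA ltrD2l ltr_pdivrMr// => xAB; simpl in *.
  apply: lt_le_trans xAB _; nra.
simpl in *.
have : x < A' w * X w.
  have -> : x = K^-1 * (x * K) by field; rewrite gt_eqF.
  apply: (@le_lt_trans _ _ (A' w * (x * K))).
    by apply: ler_wpM2r; [rewrite mulr_ge0// ltW|exact: ltW].
  by rewrite ltr_pM2l//; apply: lt_trans KA; rewrite invr_gt0.
lra.
Qed.

(** Thresholds e^u - 1 for X are thresholds u for log(1 + X). The three terms correspond to log(1 +
    A + B) above t - L, at most L, and in between. In the last case, conditioning on log(1 + A + B)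
    = s and bounding the tail of log(1 + X) at t - s by K h(t - s) replaces log(1 + X) by an
    independent variable of law H, at the price of the factor K. *)
Lemma affine_tail_le (K L t : R) : 0 <= K -> 0 <= L ->
  {ae P, forall w, 0 <= X w} ->
  (forall u, pr P [set w | expR u - 1 < X w] <= K * h u) ->
  pr P [set w | expR t - 1 < A' w * X w + B' w] <=
  h (t - L) + (1 - p0) * pr P [set w | expR (t - L) - 1 < X w] +
  K * pr (product_law H H) [set z | [/\ L < z.1, L < z.2 & t < z.1 + z.2]].
Proof.
move=> K0 L0 X0 XK.
have mxiL : measurable [set w | t - L < xi w] by exact: measurable_gtr.
pose S2 := X @^-1` [set y | expR (t - L) - 1 < y] `&`
  [set w | (~` [set z : R * R | z.1 = 0]) (A' w, B' w)].
have mz : measurable (~` [set z : R * R | z.1 = 0]).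
  by apply: measurableC; exact: measurable_eqr.
have mS2 : measurable S2.
  apply: measurableI; first exact: measurable_gtr.
  exact: (measurable_funT_preimage mpair mz).
pose V := [set z : R * R | L < z.1 /\ z.1 <= t - L /\ expR (t - z.1) - 1 < z.2].
have mV : measurable V.
  apply: measurableI; first exact: measurable_gtr.
  apply: measurableI; first exact: measurable_ger.
  apply: measurable_gtr => //; apply: measurable_funB => //.
  by apply: measurableT_comp => //; exact: measurable_funB.
pose xiX w := (xi w, X w).
have mxiX : measurable_fun setT xiX by exact: measurable_fun_pair.
have mS3 : measurable (xiX @^-1` V) by exact: measurable_funT_preimage.
apply: (@le_trans _ _ (pr P ([set w | t - L < xi w] `|` (S2 `|` xiX @^-1` V)))).
  apply: pr_ae_le.
  - by apply: measurable_gtr => //; apply: measurable_funD => //; exact: measurable_funM.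
  - by do 2 apply: measurableU => //.
  have := input_ge0; have := input_gt0; move: X0.
  apply: filterS3 => w /= Xw Bw Aw; rewrite ltrBlDr => tD.
  have [|xit] := ltP (t - L) (xi w); [by left|right].
  have pos : 0 < 1 + A' w + B' w by rewrite ltr_wpDl// addr_ge0.
  have exi : expR (xi w) = 1 + A' w + B' w by rewrite /xi lnK.
  (* If A = 0, then e^t < 1 + B = e^xi, against xi <= t - L. Excluding this case is what produces
     the factor 1 - p0. *)
  have [A0|A0] := eqVneq (A' w) 0.
    exfalso; move: tD; rewrite A0 mul0r add0r => tB.
    have : expR t < expR (xi w) by rewrite exi A0 addr0 addrC.
    by rewrite ltr_expR; move: xit; lra.
  have tX : expR t < expR (xi w) * (1 + X w).
    by rewrite exi; apply: lt_le_trans tD _; nra.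
  have tX' : expR (t - xi w) - 1 < X w.
    rewrite ltrBlDl expRD expRN -ltr_pdivlMr ?invr_gt0 ?expR_gt0// invrK.
    by rewrite mulrC.
  have [xiL|xiL] := leP (xi w) L; last by right.
  left; split; last by move=> /= A0'; rewrite A0' eqxx in A0.
  by rewrite /=; apply: le_lt_trans tX'; rewrite lerD2r ler_expR lerD2l lerN2.
apply: le_trans (prU_le P _ _) _ => //; first exact: measurableU.
rewrite xi_tail -addrA lerD2l; apply: le_trans (prU_le P _ _) _ => //.
apply: lerD.
  case: inp => _ _ _ _ ind; rewrite ind//; last exact: measurable_gt.
  rewrite mulrC le_eqVlt; apply/orP; left; apply/eqP; congr (_ * _).
  have mA0 : measurable (A @^-1` [set 0]) by exact: measurable_funT_preimage.
  by rewrite (pr_law mz) (_ : p0 = pr P0 (A @^-1` [set 0]))// -prC.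
pose FX : {mfun T >-> R} := HB.pack X (isMeasurableFun.Build _ _ _ _ X mX).
pose Fxi : {mfun T >-> R} := HB.pack xi (isMeasurableFun.Build _ _ _ _ xi mxi).
rewrite (@pr_pair_product _ _ _ P _ _ _ _ xi X mxi mX Fxi FX)//; last first.
  move=> U U' mU mU'; rewrite setIC mulrC.
  pose W := [set z : R * R | U (ln (1 + z.1 + z.2))].
  have mW : measurable W.
    by apply: (measurable_funT_preimage _ mU); exact: measurable_log1p_add.
  by case: inp => _ _ _ _ /(_ _ _ mU' mW).
set W := [set z | _]; have mW : measurable W.
  have -> : W = [set z | L < z.1] `&` [set z | L < z.2] `&` [set z | t < z.1 + z.2].
    by apply/seteqP; split=> z /= [] => [? ? ?|[? ?] ?].
  apply: measurableI; first by apply: measurableI; exact: measurable_gtr.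
  by apply: measurable_gtr => //; exact: measurable_funD.
(* Both sides become integrals of section probabilities over the law of xi, which is H; the
   comparison is then made section by section. *)
rewrite -lee_fin EFinM !prE// /product_law/= /product_measure1.
rewrite [X in (_ <= _ * X)%E](_ : _ =
    \int[distribution P Fxi]_x (H \o xsection W) x)%E; last first.
  apply: eq_measure_integral => U mU _.
  by rewrite -[LHS]prE// -xi_law// -[RHS]prE.
rewrite -ge0_integralZl//; last exact: measurable_fun_xsection.
apply: ge0_le_integral => //.
- exact: measurable_fun_xsection.
- by apply: measurable_funeM; exact: measurable_fun_xsection.
move=> s _ /=.
have mWs : measurable (xsection W s) by exact: measurable_xsection.
have mVs : measurable (xsection V s) by exact: measurable_xsection.
rewrite -[leLHS]prE// -[X in (_ * X)%E]prE// -EFinM lee_fin.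
(* Other s give an empty section of [V]. For these s, any y > t - s also exceeds L, so (s, y) lies
   in [W]. *)
have [/andP[Ls st]|Lst] := boolP (L < s <= t - L).
  apply: (@le_trans _ _ (pr P [set w | expR (t - s) - 1 < X w])).
    rewrite (_ : pr (distribution P FX) _ = pr P (X @^-1` (xsection V s)))//.
    apply: pr_le.
    - exact: (@measurable_funT_preimage _ _ _ _ X (xsection V s)).
    - exact: measurable_gtr.
    - by move=> w /=; rewrite /xsection/= inE /V/= => -[_ [_ ]].
  apply: le_trans (XK _) _; apply: ler_wpM2l => //.
  rewrite tailE; apply: pr_le => //; first exact: measurable_gt.
  move=> y /= tsy; rewrite /xsection/= inE /W/=; split => //; simpl in *; lra.
rewrite (_ : xsection V s = set0).
  by rewrite /pr measure0/= mulr_ge0// pr_ge0.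
apply/seteqP; split=> // y; rewrite /xsection/= inE /V/= => -[Ls [st _]].
by move/negP : Lst; apply; rewrite Ls st.
Qed.


End affine_step.

(** * Shifts of long tails and the error budget of one step *)

Lemma long_tailed_shift (R : realType) (H : probability R R) (y e : R) :
  long_tailed H -> 0 < e ->
  exists M, forall t, M <= t -> (1 - e) * tail H t <= tail H (t + y) <= (1 + e) * tail H t.
Proof.
move=> [h0 /(_ y)/cvgr_pinfty_dist hy] e0; have [M hM] := hy _ e0.
by exists M => t /hM; rewrite ler_distl ler_pdivlMr// ler_pdivrMr.
Qed.

(** In the application u = h(ln x), [hv] = h(ln(1 + x/delta)), g = h(ln(x K)), f = P(X > x K), a =
    P(X > delta), [pA] = P(A > 1/K) and [pi] = 1/p0. The factor 1 - p shrinks the inherited error e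
    to (1 - p) e; the freed p e pays for the losses eta (2 + 3 pi). *)
Fact lower_step_arith (R : realFieldType) (p e eta u hv g f a pA cn pi : R) :
  0 < eta -> eta <= (1 - p) / 2 -> 0 < 1 - p -> 0 <= p -> 0 < e ->
  eta * (2 + 3 * pi) <= p * e -> 0 <= u ->
  (1 - eta) * u <= hv -> 1 - eta <= a -> hv <= eta -> (1 - eta) * u <= g ->
  (cn - e) * g <= f -> 0 <= f -> 0 <= cn -> cn <= pi -> 1 - p - eta <= pA ->
  (1 + (1 - p) * cn - e) * u <= a * hv + f * (pA - hv).
Proof.
move=> eta0 eta1 q0 p00 e0 eta2 h0 v2 v4 v1 x_3 v3 f0 c0 cp Ak.
have ab : (1 - 2 * eta) * u <= a * hv.
  have : (1 - eta) * ((1 - eta) * u) <= a * hv.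
    by apply: ler_pM => //; [lra|rewrite mulr_ge0//; lra].
  have : 0 <= eta * eta * u by rewrite !mulr_ge0// ltW.
  lra.
suff fb : ((1 - p) * (cn - e) - 3 * eta * pi) * u <= f * (pA - hv).
  have : 0 <= (p * e - eta * (2 + 3 * pi)) * u by rewrite mulr_ge0// subr_ge0.
  lra.
have fq : f * (1 - p - 2 * eta) <= f * (pA - hv) by rewrite ler_wpM2l//; lra.
apply: le_trans fq.
have pi0 : 0 <= pi by apply: le_trans cp.
have epi : 0 <= eta * pi * u by rewrite !mulr_ge0// ltW.
(* For cn <= e the inherited bound is nonpositive and f >= 0 suffices; only for cn > e may it be
   multiplied by the lower bound on g. *)
have [ce|ce] := leP cn e.
  apply: (@le_trans _ _ 0); last by rewrite mulr_ge0//; lra.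
  have : 0 <= (1 - p) * (e - cn) * u by rewrite !mulr_ge0//; lra.
  lra.
have fc : (cn - e) * ((1 - eta) * u) <= f.
  by apply: le_trans v3; rewrite ler_wpM2l//; lra.
have : (cn - e) * ((1 - eta) * u) * (1 - p - 2 * eta) <= f * (1 - p - 2 * eta).
  by rewrite ler_wpM2r//; lra.
apply: le_trans.
have : 0 <= (cn - e) * u * (eta * (2 * eta + p)).
  by rewrite !mulr_ge0//; lra.
have : 0 <= (pi - (cn - e)) * (3 * eta * u).
  by rewrite !mulr_ge0//; lra.
lra.
Qed.

(** Here u = h(t), g = h(t - L) and f is the tail of log(1 + X) at t - L. The coefficient of K is (1
    - p)(1 + p/4) + p/4 <= 1 - p/2, and K p >= 4 lets K p/2 absorb the remaining 1 + p/4, so the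
    bound K reproduces itself. *)
Fact upper_step_arith (R : realFieldType) (p K u g f : R) :
  0 < p -> p < 1 -> 4 <= K * p -> 0 <= u -> g <= (1 + p / 4) * u -> f <= K * g ->
  g + (1 - p) * f + K * (p / 4 * u) <= K * u.
Proof.
move=> p0 p1 K4 u0 gu fg.
have K0 : 0 <= K by rewrite -(pmulr_lge0 _ p0) (le_trans _ K4).
have : (1 - p) * f <= (1 - p) * (K * ((1 + p / 4) * u)).
  apply: ler_wpM2l; first by rewrite subr_ge0 ltW.
  by apply: (le_trans fg); exact: ler_wpM2l.
have : 0 <= (K * p - 4) * u by rewrite mulr_ge0// subr_ge0.
have : 0 <= K * p * p * u by rewrite !mulr_ge0// ltW.
have : 0 <= (1 - p) * u by rewrite mulr_ge0// subr_ge0 ltW.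
lra.
Qed.

(** With z = q^m, the factor 1 - p again frees p e. The equations for [eta] and [eps] limit the two
    errors, from the shift by L and from two large summands, to p e/2 each. *)
Fact upper_sharp_arith (R : realFieldType) (p pi K e eta eps cn z u g f : R) :
  0 < p -> p < 1 -> 0 <= K -> 0 <= e -> 0 <= u -> 0 <= eta ->
  0 <= cn -> cn <= pi -> 0 <= z -> z <= 1 ->
  eta * (2 * (1 + pi + e + K)) = p * e -> eps * (2 * (K + 1)) = p * e -> 0 <= eps ->
  g <= (1 + eta) * u -> f <= (cn + e + K * z) * g ->
  g + (1 - p) * f + K * (eps * u) <= (1 + (1 - p) * cn + e + K * ((1 - p) * z)) * u.
Proof.
move=> p0 p1 K0 e0 u0 eta0 c0 cp z0 z1 etaE epsE eps0 gu fg.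
have w0 : 0 <= cn + e + K * z by rewrite !addr_ge0// mulr_ge0.
have wle : cn + e + K * z <= pi + e + K.
  by rewrite !lerD// ler_piMr.
have {}fg : (1 - p) * f <= (1 - p) * ((cn + e + K * z) * ((1 + eta) * u)).
  apply: ler_wpM2l; first by rewrite subr_ge0 ltW.
  by apply: (le_trans fg); exact: ler_wpM2l.
(* An opaque name keeps the products with this sum atomic for [lra]. *)
have [w wE] : exists w, w = cn + e + K * z by exists (cn + e + K * z).
rewrite -wE in w0 wle fg.
have h1 : 0 <= p * (w * (eta * u)) by rewrite !mulr_ge0// ltW.
have h2 : 0 <= (pi + e + K - w) * (eta * u) by rewrite !mulr_ge0// subr_ge0.
have h3 : 0 <= eps * u by rewrite mulr_ge0.
have h4 : eta * (2 * (1 + pi + e + K)) * u = p * e * u by rewrite etaE.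
have h5 : eps * (2 * (K + 1)) * u = p * e * u by rewrite epsE.
have h6 : (1 - p) * (w * u) = (1 - p) * ((cn + e + K * z) * u) by rewrite wE.
lra.
Qed.

(** * Iterated affine steps: bounds uniform in the number of steps *)

Section affine_iteration.
Context (R : realType) (d0 : measure_display) (T0 : measurableType d0).
Variables (P0 : probability T0 R) (A B : {RV P0 >-> R}).
Hypotheses (A_ge0 : {ae P0, forall w, 0 <= A w}) (B_gt0 : {ae P0, forall w, 0 < B w}).
Context (d : measure_display) (T : measurableType d) (P : probability T R).

Local Notation H := (distribution P0 (log1pD A B)).
Local Notation h := (tail H).
Local Notation p0 := (pmf A 0).

Hypotheses (p0_gt0 : 0 < p0) (p0_lt1 : p0 < 1).

(** The geometric sum 1 + q + ... + q^(n-1) with q = 1 - p0. *)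
Definition affine_coef (n : nat) : R := (1 - (1 - p0) ^+ n) / p0.
Local Notation c := affine_coef.

Lemma affine_coef0 : c 0 = 0.
Proof. by rewrite /c expr0 subrr mul0r. Qed.

Lemma affine_coefS n : c n.+1 = 1 + (1 - p0) * c n.
Proof. by rewrite /c exprS; field; rewrite gt_eqF. Qed.

Lemma affine_coef_le n : c n <= p0^-1.
Proof.
rewrite /c ler_pdivrMr// mulVf ?gt_eqF// gerBl exprn_ge0//.
by rewrite subr_ge0 ltW.
Qed.

Lemma affine_coef_ge1 n : 1 <= c n.+1.
Proof.
elim: n => [|n IH]; first by rewrite affine_coefS affine_coef0 mulr0 addr0.
rewrite affine_coefS lerDl mulr_ge0//; first by rewrite subr_ge0 ltW.
exact: le_trans IH.
Qed.

Lemma affine_coef_ge0 n : 0 <= c n.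
Proof.
by case: n => [|n]; [rewrite affine_coef0|exact: le_trans (affine_coef_ge1 n)].
Qed.

Lemma affine_coef_approx e : 0 < e -> exists n, p0^-1 - e <= c n.
Proof.
move=> e0; have qlt : `|1 - p0| < 1.
  by rewrite ger0_norm ?gtrBl// subr_ge0 ltW.
have pe0 : 0 < p0 * e by rewrite mulr_gt0.
have /cvgrPdist_le/(_ _ pe0)[n _ /(_ n (leqnn n))] := cvg_expr qlt.
rewrite /= sub0r normrN => qn; exists n; rewrite /c mulrBl mul1r lerD2l lerN2.
by rewrite ler_pdivrMr// mulrC; apply: le_trans qn; exact: ler_norm.
Qed.

Variable init : (T -> R) -> Prop.

(** A predicate on random variables rather than a sequence, so that it covers both the forward chain
    and the reversed sums. [init] is a class because reversed sums may start from different B_k. *)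
Inductive affine_iter : nat -> (T -> R) -> Prop :=
| affine_iter0 X : init X -> affine_iter 0 X
| affine_iterS n A' B' X : affine_iter n X -> affine_input A B P A' B' X ->
    affine_iter n.+1 (fun w => A' w * X w + B' w).

Hypothesis init_measurable : forall X, init X -> measurable_fun setT X.
Hypothesis init_ge0 : forall X, init X -> {ae P, forall w, 0 <= X w}.

Lemma affine_iter_measurable n X : affine_iter n X -> measurable_fun setT X.
Proof.
elim=> {n X} [X /init_measurable//|n A' B' X _ mX [mA' mB' _ _ _]].
by apply: measurable_funD => //; exact: measurable_funM.
Qed.

Lemma affine_iter_ge0 n X : affine_iter n X -> {ae P, forall w, 0 <= X w}.
Proof.
elim=> {n X} [X /init_ge0//|n A' B' X _ X0 inp].
have := input_ge0 A_ge0 inp; have := input_gt0 B_gt0 inp; move: X0.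
by apply: filterS3 => w Xw Bw Aw; rewrite addr_ge0 ?mulr_ge0// ltW.
Qed.

Let measurable_iter_gt n X x : affine_iter n X -> measurable [set w | x < X w].
Proof. by move=> /affine_iter_measurable mX; exact: measurable_gtr. Qed.

Let pr_A_gt0 : pr P0 [set w | 0 < A w] = 1 - p0.
Proof.
have mA : measurable_fun setT A by [].
have mA0 : measurable (A @^-1` [set 0]) by exact: measurable_funT_preimage.
rewrite (_ : p0 = pr P0 (A @^-1` [set 0]))// -prC//.
apply: pr_ae_eq; [exact: measurable_gtr|exact: measurableC|].
apply: filterS A_ge0 => w /= Aw; rewrite lt_neqAle Aw andbT eq_sym.
by split => [/eqP|/eqP].
Qed.

(** The assumption on [init] asks for one delta common to all starting variables, since M may depend
    neither on n nor on X. *)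
Lemma affine_iter_tail_ge e : long_tailed H ->
  (forall eta, 0 < eta -> exists2 delta, 0 < delta <= 1 &
    forall X, init X -> 1 - eta <= pr P [set w | delta < X w]) ->
  0 < e -> exists M, forall n X x, affine_iter n X -> M <= x ->
    (c n - e) * h (ln x) <= pr P [set w | x < X w].
Proof.
move=> lH init_pos e0.
have q0 : 0 < 1 - p0 by rewrite subr_gt0.
have s0 : 0 < 2 + 3 / p0 by rewrite addr_gt0// divr_gt0.
(* The first bound keeps 1 - p0 - 2 eta nonnegative; the second fits the losses of a step into the
   freed p0 e. *)
pose eta := Num.min ((1 - p0) / 2) (p0 * e / (2 + 3 / p0)).
have eta0 : 0 < eta by rewrite lt_min !divr_gt0// mulr_gt0.
have eta1 : eta <= (1 - p0) / 2 by rewrite ge_min lexx.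
have eta2 : eta * (2 + 3 / p0) <= p0 * e.
  by rewrite -ler_pdivlMr// ge_min lexx orbT.
clearbody eta.
have [delta1 /andP[delta10 delta11] init1] := init_pos _ eta0.
have mB : measurable_fun setT B by [].
have [delta2 /andP[delta20 delta21] B2] := pr_gt0_approx P0 mB eta0.
have {}B2 : 1 - eta <= pr P0 [set w | delta2 < B w].
  by rewrite -(pr_ae1 (P := P0) (S := [set w | 0 < B w]))//; exact: measurable_gtr.
have [delta [delta01 delta_1 delta_2]] : exists delta,
    [/\ 0 < delta <= 1, delta <= delta1 & delta <= delta2].
  exists (Num.min delta1 delta2); rewrite lt_min delta10 delta20 !ge_min delta11.
  by rewrite !lexx orbT.
have delta0 : 0 < delta by case/andP: delta01.
(* After at least one step the variable dominates the last B, whose law does not change with n;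
   hence one delta serves all n. *)
have iter_pos n X : affine_iter n X -> 1 - eta <= pr P [set w | delta < X w].
  move=> iX; have mXd := measurable_iter_gt delta iX.
  case: iX mXd => {n X} [X iX|n A' B' X iX inp] mXd.
    apply: (le_trans (init1 _ iX)); apply: pr_le => //.
      by apply: measurable_gtr => //; exact: init_measurable.
    by move=> w /=; exact: le_lt_trans.
  apply: (le_trans B2); rewrite -(input_tail2 inp); apply: pr_ae_le => //.
    by apply: measurable_gtr => //; exact: (input_measurable2 inp).
  have := input_ge0 A_ge0 inp; have := affine_iter_ge0 iX.
  apply: filterS2 => w /= Xw Aw dB; apply: (le_lt_trans delta_2).
  by apply: (lt_le_trans dB); rewrite lerDr mulr_ge0.
have mA : measurable_fun setT A by [].
have [k /andP[k0 k1] Ak] := pr_gt0_approx P0 mA eta0.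
rewrite pr_A_gt0 in Ak.
have [N1 hN1] := tail_cvg0 H eta0.
(* For x >= 1, ln(1 + x/delta) <= ln x + ln(2/delta). The shift by ln(1/k) below leads to the
   threshold x/k >= x of the induction hypothesis. *)
have [N2 hN2] := long_tailed_shift (ln (2 / delta)) lH eta0.
have [N3 hN3] := long_tailed_shift (ln k^-1) lH eta0.
pose N := Num.max 0 (Num.max N1 (Num.max N2 N3)).
exists (expR N) => n X x iX; elim: iX x => {n X} [X _|n A' B' X iX IH inp] x Nx.
  rewrite affine_coef0 sub0r; apply: le_trans (pr_ge0 _ _).
  by rewrite mulNr oppr_le0 mulr_ge0 ?tail_ge0// ltW.
have x0 : 0 < x by apply: lt_le_trans Nx; exact: expR_gt0.
have : N <= ln x by rewrite -(expRK N) ler_ln ?posrE// expR_gt0.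
rewrite !ge_max => /and4P[x1 /hN1 x_1 /hN2/andP[x_2 _] /hN3/andP[x_3 _]].
have {}x1 : 1 <= x.
  by apply: le_trans Nx; rewrite -expR0 ler_expR le_max lexx.
have K0 : 0 < k^-1 by rewrite invr_gt0.
apply: le_trans (affine_tail_ge A_ge0 B_gt0 inp delta01 K0 (ltW x0) (affine_iter_ge0 iX)).
rewrite invrK.
have v1 : h (ln (1 + x / delta)) <= eta.
  apply: le_trans x_1; apply: tail_anti; rewrite ler_ln ?posrE//; last first.
    by rewrite ltr_wpDr// divr_ge0// ltW.
  apply: (@le_trans _ _ (x / delta)); last by rewrite lerDr.
  rewrite ler_pdivlMr//; apply: ler_piMr; first exact: ltW.
  by case/andP: delta01.
have v2 : (1 - eta) * h (ln x) <= h (ln (1 + x / delta)).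
  apply: (le_trans x_2); apply: tail_anti.
  rewrite -lnM ?posrE//; last by rewrite divr_gt0.
  rewrite ler_ln ?posrE//; [|by rewrite ltr_wpDr// divr_ge0// ltW|by rewrite mulr_gt0// divr_gt0].
  have -> : x * (2 / delta) = x / delta + x / delta by field; rewrite gt_eqF.
  rewrite lerD2r ler_pdivlMr// mul1r.
  by apply: le_trans x1; case/andP: delta01.
have xK : expR N <= x * k^-1.
  apply: (le_trans Nx); apply: ler_peMr; first exact: ltW.
  by rewrite invf_ge1.
have v3 := IH _ xK; rewrite lnM ?posrE// in v3.
have v4 := iter_pos _ _ iX.
have f0 := pr_ge0 P [set w | x * k^-1 < X w].
have c0 := affine_coef_ge0 n; have cp := affine_coef_le n.
have h0 := tail_ge0 H (ln x).
rewrite affine_coefS.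
apply: (lower_step_arith eta0 eta1 q0 _ e0 _ h0 v2 v4 v1 x_3 v3 f0 c0 cp Ak).
  exact: ltW.
exact: eta2.
Qed.

Section upper_bound.
Hypothesis subH : subexponential H.
Hypothesis init_small : forall e, 0 < e -> exists M, forall X t, init X -> M <= t ->
  pr P [set w | expR t - 1 < X w] <= e * h t.

Let h_gt0 t : 0 < h t. Proof. by case: subH. Qed.

(** The order of quantifiers matters: L and M are fixed before K, so K may afterwards be chosen in
    terms of M. *)
Let tail_step eta eps : 0 < eta -> 0 < eps ->
  exists L M, forall K n A' B' X t, affine_iter n X -> affine_input A B P A' B' X ->
    0 <= K -> (forall u, pr P [set w | expR u - 1 < X w] <= K * h u) -> M <= t ->
    h (t - L) <= (1 + eta) * h t /\
    pr P [set w | expR t - 1 < A' w * X w + B' w] <=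
    h (t - L) + (1 - p0) * pr P [set w | expR (t - L) - 1 < X w] + K * (eps * h t).
Proof.
move=> eta0 eps0.
have [L [M1 [L0 hM1]]] := subexponential_two_large subH eps0.
have [M2 hM2] := subexponential_shift subH L0 eta0.
exists L, (Num.max M1 M2) => K n A' B' X t iX inp K0 XK.
rewrite ge_max => /andP[M1t M2t]; split; first exact: hM2.
apply: (le_trans (affine_tail_le A_ge0 B_gt0 inp t K0 L0 (affine_iter_ge0 iX) XK)).
by rewrite lerD2l ler_wpM2l// hM1.
Qed.

Lemma affine_iter_tail_bounded : exists2 K, 0 <= K & forall n X t,
  affine_iter n X -> pr P [set w | expR t - 1 < X w] <= K * h t.
Proof.
have p40 : 0 < p0 / 4 by rewrite divr_gt0.
have [L [M1 hM1]] := tail_step p40 p40.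
have [M2 hM2] := init_small ltr01.
pose M := Num.max M1 M2; have hM := h_gt0 M.
(* The summand 1 covers starting variables beyond M, 4/p0 makes the inductive step close, and 1/h(M)
   makes the bound at least 1 for t <= M. *)
pose K := 1 + 4 / p0 + (h M)^-1.
have K0 : 0 <= K by rewrite !addr_ge0// ltW// ?invr_gt0// divr_gt0.
have Ksmall t S : measurable S -> t <= M -> pr P S <= K * h t.
  move=> mS tM; apply: (le_trans (pr_le1 P mS)).
  apply: (@le_trans _ _ (K * h M)); last by apply: ler_wpM2l => //; exact: tail_anti.
  rewrite -[leLHS](mulVf (lt0r_neq0 hM)) ler_wpM2r//; first exact: ltW.
  by rewrite lerDr addr_ge0// divr_ge0// ltW.
exists K => // n X t iX; elim: iX t => {n X} [X iX|n A' B' X iX IH inp] t.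
  have [tM|Mt] := leP t M.
    by apply: Ksmall => //; apply: (@measurable_iter_gt 0); exact: affine_iter0.
  apply: le_trans (hM2 _ _ iX _) _.
    by apply: le_trans (ltW Mt); rewrite le_max lexx orbT.
  rewrite ler_wpM2r//; first exact: ltW.
  by rewrite /K -addrA lerDl addr_ge0// ?invr_ge0 ?divr_ge0// ltW.
have [tM|Mt] := leP t M.
  by apply: Ksmall => //; apply: (@measurable_iter_gt n.+1); exact: affine_iterS.
have M1t : M1 <= t by apply: le_trans (ltW Mt); rewrite le_max lexx.
have [st /le_trans] := hM1 _ _ _ _ _ _ iX inp K0 IH M1t; apply.
have K4 : 4 <= K * p0.
  rewrite -ler_pdivrMr// /K addrAC lerDr addr_ge0// invr_ge0; exact: ltW.
exact: (upper_step_arith p0_gt0 p0_lt1 K4 (ltW (h_gt0 t)) st (IH (t - L))).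
Qed.

Lemma affine_iter_tail_le e : 0 < e -> exists M, forall n X t,
  affine_iter n X -> M <= t -> pr P [set w | expR t - 1 < X w] <= (c n + e) * h t.
Proof.
move=> e0; have [K K0 hK] := affine_iter_tail_bounded.
have q0 : 0 < 1 - p0 by rewrite subr_gt0.
pose e' := e / 2; have e'0 : 0 < e' by rewrite divr_gt0.
pose s := 1 + p0^-1 + e' + K.
have s0 : 0 < s by rewrite ltr_wpDr// addr_gt0// addr_gt0// invr_gt0.
pose eta := p0 * e' / (2 * s).
have eta0 : 0 < eta by rewrite divr_gt0// mulr_gt0.
(* The divisor is K + 1 because only K >= 0 is known. *)
pose eps := p0 * e' / (2 * (K + 1)).
have K10 : 0 < K + 1 by rewrite ltr_wpDl.
have eps0 : 0 < eps by rewrite divr_gt0// mulr_gt0.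
have [L [M1 hM1]] := tail_step eta0 eps0.
have [M2 hM2] := init_small e'0.
(* Induction on m, not on n: peeling off the last step uses the bound for m at t - L. Thus M grows
   with m only, and the steps below the m-th are covered by the crude K. *)
have bound m : exists M, forall n X t, affine_iter n X -> M <= t ->
    pr P [set w | expR t - 1 < X w] <= (c n + e' + K * (1 - p0) ^+ m) * h t.
  elim: m => [|m [M hM]].
    exists 0 => n X t iX _; apply: (le_trans (hK _ _ _ iX)).
    rewrite expr0 mulr1 ler_wpM2r//; first exact: ltW.
    by rewrite lerDr addr_ge0 ?affine_coef_ge0// ltW.
  exists (Num.max M2 (Num.max M1 (M + L))) => n X t iX.
  rewrite !ge_max => /and3P[M2t M1t MLt].
  have qm : 0 <= (1 - p0) ^+ m <= 1.
    apply/andP; split; first by apply: exprn_ge0; exact: ltW.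
    by apply: exprn_ile1; [exact: ltW|rewrite gerBl ltW].
  have ht := h_gt0 t.
  case: iX => {n X} [X iX|n A' B' X iX inp].
    apply: le_trans (hM2 _ _ iX M2t) _; rewrite ler_wpM2r//; first exact: ltW.
    rewrite affine_coef0 add0r lerDl; apply: mulr_ge0 => //.
    by apply: exprn_ge0; exact: ltW.
  have [st /le_trans] := hM1 _ _ _ _ _ _ iX inp K0 (fun u => hK _ _ u iX) M1t; apply.
  have tL : M <= t - L by rewrite lerBrDr.
  rewrite affine_coefS exprS.
  have /andP[qm0 qm1] := qm.
  apply: (upper_sharp_arith p0_gt0 p0_lt1 K0 (ltW e'0) (ltW ht) (ltW eta0)
    (affine_coef_ge0 n) (affine_coef_le n) qm0 qm1 _ _ (ltW eps0) st (hM _ _ _ iX tL)).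
  - by rewrite /eta divfK// gt_eqF// mulr_gt0.
  - by rewrite /eps divfK// gt_eqF// mulr_gt0.
have qlt : `|1 - p0| < 1 by rewrite ger0_norm ?gtrBl// ltW.
have eK : 0 < e' / (K + 1) by rewrite divr_gt0.
have /cvgrPdist_le/(_ _ eK)[m _ /(_ m (leqnn m))] := cvg_expr qlt.
rewrite /= sub0r normrN ger0_norm => [qm|]; last by apply: exprn_ge0; exact: ltW.
have [M hM] := bound m; exists M => n X t iX Mt.
apply: (le_trans (hM _ _ _ iX Mt)); apply: ler_wpM2r; first exact: ltW.
rewrite -addrA lerD2l.
have -> : e = e' + e' by rewrite /e'; field.
rewrite lerD2l; apply: (@le_trans _ _ (K * (e' / (K + 1)))); first exact: ler_wpM2l.
rewrite mulrA ler_pdivrMr// mulrC; apply: ler_wpM2l; first exact: ltW.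
by rewrite lerDl.
Qed.
End upper_bound.
End affine_iteration.

(** * Independence from finite cylinders of a family *)

Section independent_family.
Context (d : measure_display) (T : measurableType d) (R : realType).
Variables (P : probability T R) (I : choiceType) (F : I -> set (set T)).
Hypothesis F_measurable : forall i, F i `<=` measurable.
Hypothesis F_indep : mutually_independent P F.

Let cylinder (J : {fset I}) (E : I -> set T) := \bigcap_(i in [set` J]) E i.

Let cylinder_measurable (J : {fset I}) (E : I -> set T) :
  (forall i, i \in J -> F i (E i)) -> measurable (cylinder J E).
Proof.
move=> FE; apply: fin_bigcap_measurable => // i /= iJ.
by apply: F_measurable; exact: FE.
Qed.

Let extend (k : I) (V : set T) (E : I -> set T) i := if i == k then V else E i.

Let extend_in (k : I) (V : set T) (J : {fset I}) (E : I -> set T) :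
  F k V -> (forall i, i \in J -> F i (E i)) ->
  forall i, i \in (k |` J)%fset -> F i (extend k V E i).
Proof.
move=> FV FE i; rewrite !inE /extend; have [->|ik] := eqVneq i k => //=.
exact: FE.
Qed.

Let cylinder_extend (k : I) (V : set T) (J : {fset I}) (E : I -> set T) :
  k \notin J -> cylinder (k |` J)%fset (extend k V E) = V `&` cylinder J E.
Proof.
move=> kJ; rewrite /cylinder set_fsetU1 bigcap_setU1 /extend eqxx; congr (_ `&` _).
apply: eq_bigcapr => i /= iJ; case: eqVneq => // ik.
by rewrite -ik iJ in kJ.
Qed.

Lemma pr_setI_cylinder (k : I) (V : set T) (J : {fset I}) (E : I -> set T) :
  k \notin J -> F k V -> (forall i, i \in J -> F i (E i)) ->
  pr P (V `&` \bigcap_(i in [set` J]) E i) =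
  pr P V * pr P (\bigcap_(i in [set` J]) E i).
Proof.
move=> kJ FV FE; apply: EFin_inj.
have mV := F_measurable FV; have mc := cylinder_measurable FE.
rewrite EFinM !prE//; last exact: measurableI.
rewrite -/(cylinder J E) -(cylinder_extend V E kJ) /cylinder F_indep; last exact: extend_in.
rewrite F_indep// big_fsetU1//= {1}/extend eqxx; congr (_ * _)%E.
apply: eq_big_seq => i iJ; rewrite /extend; case: eqVneq => // ik.
by rewrite -ik iJ in kJ.
Qed.

(** Independence is tested on finite intersections only, which avoids the joint sigma-algebra of
    infinitely many inputs; [D] is the set of indices not yet consumed. *)
Definition independent_from d' (S : measurableType d') (X : T -> S) (D : set I) :=
  forall (J : {fset I}) (E : I -> set T) (U : set S),
    (forall i, i \in J -> D i /\ F i (E i)) -> measurable U ->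
    pr P (X @^-1` U `&` \bigcap_(i in [set` J]) E i) =
    pr P (X @^-1` U) * pr P (\bigcap_(i in [set` J]) E i).

Lemma independent_from_generator d' (S : measurableType d') (X : T -> S) k D :
  (forall U, measurable U -> F k (X @^-1` U)) -> ~ D k -> independent_from X D.
Proof.
move=> FX Dk J E U JE mU; apply: (@pr_setI_cylinder k).
- by apply/negP => /JE[].
- exact: FX.
- by move=> i /JE[].
Qed.

Lemma independent_from_cst d' (S : measurableType d') (s : S) D :
  independent_from (fun=> s) D.
Proof.
move=> J E U JE mU; rewrite preimage_cst; case: ifPn => _.
  by rewrite setTI pr_setT mul1r.
by rewrite set0I /pr measure0 mul0r.
Qed.

Section combine.
Context d1 d2 d3 (S1 : measurableType d1) (S2 : measurableType d2) (S3 : measurableType d3).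
Variables (X : T -> S1) (Y : T -> S2) (f : S1 * S2 -> S3) (D : set I) (k : I).
Hypotheses (mX : measurable_fun setT X) (mY : measurable_fun setT Y).
Hypotheses (mf : measurable_fun setT f).
Hypotheses (FY : forall U, measurable U -> F k (Y @^-1` U)).
Hypotheses (Dk : D k) (XD : independent_from X D).

Lemma independent_from_pair (U : set S1) (V : set S2) :
  measurable U -> measurable V ->
  pr P (X @^-1` U `&` Y @^-1` V) = pr P (X @^-1` U) * pr P (Y @^-1` V).
Proof.
move=> mU mV; have := XD (J := [fset k]%fset) (E := fun=> Y @^-1` V) _ mU.
rewrite set_fset1 bigcap_set1; apply => i; rewrite inE => /eqP ->.
by split=> //; exact: FY.
Qed.

(** For a cylinder G over D', the event (Y in W) intersected with G is a cylinder over D, so X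
    splits off; then Y splits off from G since k is outside D'. This settles rectangles for (X, Y),
    and [pr_pair_setI] gives the preimages under f. *)
Lemma independent_from_comp (D' : set I) : D' `<=` D -> ~ D' k ->
  independent_from (fun w => f (X w, Y w)) D'.
Proof.
move=> D'D D'k J E U JE mU.
have JF i : i \in J -> F i (E i) by move=> /JE[].
have kJ : k \notin J by apply/negP => /JE[].
have mG := cylinder_measurable JF.
have mfU : measurable (f @^-1` U) by exact: measurable_funT_preimage.
apply: (pr_pair_setI mX mY mG) mfU => V W mV mW.
rewrite independent_from_pair// -mulrA -(pr_setI_cylinder kJ (FY mW) JF) -setIA.
rewrite -/(cylinder J E) -(cylinder_extend (Y @^-1` W) E kJ).
apply: XD => // i; rewrite !inE => /orP[/eqP ->|iJ].
  by split=> //; rewrite /extend eqxx; exact: FY.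
split; first by apply: D'D; case: (JE _ iJ).
rewrite /extend; case: eqVneq => [ik|_]; last exact: JF.
by rewrite -ik iJ in kJ.
Qed.

End combine.
End independent_family.

(** * Measurability of limits and probabilities of increasing unions *)

Lemma measurable_limn_gt d (T : measurableType d) (R : realType)
    (f : nat -> T -> \bar R) (x : \bar R) :
  (forall n, measurable_fun setT (f n)) ->
  measurable [set w | (x < limn (f ^~ w))%E].
Proof.
move=> mf; pose U w := limn_esup (f ^~ w); pose V w := limn_einf (f ^~ w).
have mU : measurable_fun setT U by exact: measurable_fun_limn_esup.
have mV : measurable_fun setT V.
  have -> : V = (fun w => - limn_esup (fun n => - f n w))%E.
    apply/funext => w; rewrite /V -[LHS]oppeK -limn_esupN; congr (- limn_esup _)%E.
  apply: measurableT_comp => //; apply: measurable_fun_limn_esup => n.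
  exact: measurableT_comp.
have mUV : measurable [set w | V w = U w].
  by rewrite -[X in measurable X]setTI; exact: measurable_eqe.
have cvgE w : cvgn (f ^~ w) <-> V w = U w.
  split=> [cf|VU]; first by rewrite /V /U is_cvg_limn_einfE// is_cvg_limn_esupE.
  apply/cvg_ex; exists (V w).
  apply: (@squeeze_cvge _ _ _ _ (einfs (f ^~ w)) _ (esups (f ^~ w))).
  - near=> n; apply/andP; split.
      by apply: ereal_inf_lbound; exists n => //=.
    by apply: ereal_sup_ubound; exists n => //=.
  - by rewrite /V limn_einf_lim; exact: is_cvg_einfs.
  - by rewrite VU /U limn_esup_lim; exact: is_cvg_esups.
(* Where the sequence converges, that is, where liminf and limsup agree, the limit is the limsup;
   elsewhere [limn] takes the default value [point]. *)
have -> : [set w | (x < limn (f ^~ w))%E] =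
    ([set w | V w = U w] `&` [set w | (x < U w)%E]) `|`
    (~` [set w | V w = U w] `&` [set w | (x < (point : \bar R))%E]).
  apply/seteqP; split=> w /=.
    move=> xl; have [VU|VU] := pselect (V w = U w).
      by left; split=> //; rewrite /U is_cvg_limn_esupE//; exact/cvgE.
    by right; split=> //; move: xl; rewrite dvgP// => /cvgE.
  move=> [[/cvgE cf]|[VU]]; first by rewrite /U is_cvg_limn_esupE.
  by rewrite dvgP// => /cvgE.
apply: measurableU; apply: measurableI.
- exact: mUV.
- rewrite -[X in measurable X]setTI; apply: measurable_lte => //.
- exact: measurableC.
- have [_|_] := boolP (x < (point : \bar R))%E.
    by rewrite (_ : [set _ | _] = setT)//; apply/seteqP; split.
  by rewrite (_ : [set _ | _] = set0)//; apply/seteqP; split.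
Unshelve. all: by end_near.
Qed.

Section limit_of_probabilities.
Context (d : measure_display) (T : measurableType d) (R : realType).
Variables (P : probability T R) (F : nat -> set T).
Hypothesis mF : forall n, measurable (F n).

(** The sets increase only almost surely. The finite unions [G n] increase everywhere and are almost
    surely contained in [F n], so continuity from below applies to them. *)
Lemma pr_bigcup_le (b : R) :
  (forall n, {ae P, forall w, F n w -> F n.+1 w}) ->
  (forall n, pr P (F n) <= b) -> pr P (\bigcup_n F n) <= b.
Proof.
move=> /ae_foralln FS Fb; pose G n := \bigcup_(m in [set m | (m <= n)%N]) F m.
have mG n : measurable (G n) by exact: bigcup_measurable.
have GE : \bigcup_n F n = \bigcup_n G n.
  apply/seteqP; split=> w [n _].
    by move=> Fw; exists n => //; exists n => /=.
  by move=> [m _ Fw]; exists m.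
have Gb n : pr P (G n) <= b.
  apply: le_trans (Fb n); apply: pr_ae_le => //.
  apply: filterS FS => w FS [m /= mn]; elim: n mn => [|n IH].
    by rewrite leqn0 => /eqP ->.
  by rewrite leq_eqVlt => /predU1P[-> //|/IH FF /FF]; exact: FS.
have GP : P \o G @ \oo --> P (\bigcup_n G n).
  apply: nondecreasing_cvg_mu => //; first exact: bigcup_measurable.
  move=> m n mn; apply/subsetPset => w [k /= km] Fw.
  by exists k => //=; exact: leq_trans mn.
rewrite GE -lee_fin prE; last exact: bigcup_measurable.
rewrite -(cvg_lim _ GP)//; apply: lime_le; first by apply/cvg_ex; eexists; exact: GP.
by apply: nearW => n /=; rewrite -prE// lee_fin.
Qed.

End limit_of_probabilities.

(** * Partial sums of the perpetuity *)

Section backward.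
Context (d : measure_display) (T : measurableType d) (R : realType).
Variables (A B : nat -> T -> R).

(* Composing the affine maps in the reversed order: [backward n 0] is the n-th
   partial sum of the perpetuity and has the law of the chain started at 0. *)
Fixpoint backward (n j : nat) (w : T) : R :=
  if n is m.+1 then A j w * backward m j.+1 w + B j w else 0.

Lemma backwardE n j w :
  backward n j w = \sum_(k < n) (\prod_(i < k) A (j + i)%N w) * B (j + k)%N w.
Proof.
elim: n j => [|n IH] j /=; first by rewrite big_ord0.
rewrite big_ord_recl big_ord0 mul1r addn0 addrC IH mulr_sumr; congr (_ + _).
apply: eq_bigr => k _; rewrite mulrA big_ord_recl addn0 addSnnS; congr (_ * _ * _).
by apply: eq_bigr => i _; rewrite addSnnS.
Qed.

Lemma perpetuityE w :
  perpetuity A B w = limn (fun n => (backward n 0 w)%:E).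
Proof.
rewrite /perpetuity; congr (limn _); apply/funext => n.
by rewrite big_mkord sumEFin backwardE.
Qed.

Lemma backward_nondecreasing w : (forall k, 0 <= A k w) -> (forall k, 0 <= B k w) ->
  nondecreasing_seq (fun n => backward n 0 w).
Proof.
move=> A0 B0; apply/nondecreasing_seqP => n; rewrite !backwardE big_ord_recr/=.
by rewrite lerDl mulr_ge0// prodr_ge0.
Qed.

(** For nonnegative terms the limit is a supremum, and a supremum lies strictly above x only if some
    member does. *)
Lemma perpetuity_gt x w : (forall k, 0 <= A k w) -> (forall k, 0 <= B k w) ->
  (x%:E < perpetuity A B w)%E <-> exists n, x < backward n 0 w.
Proof.
move=> A0 B0; rewrite perpetuityE.
have nd : nondecreasing_seq (fun n => (backward n 0 w)%:E).
  by move=> m n mn; rewrite lee_fin; exact: backward_nondecreasing.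
rewrite (cvg_lim _ (ereal_nondecreasing_cvgn nd))//; split.
  by move=> /ereal_sup_gt[_ [n _ <-]]; rewrite lte_fin; exists n.
move=> [n xn]; apply: (@lt_le_trans _ _ (backward n 0 w)%:E); first by rewrite lte_fin.
by apply: ereal_sup_ubound; exists n.
Qed.

End backward.

(** * Chain and perpetuity driven by independent pairs *)

Section driven_recursion.
Context (R : realType) (d0 : measure_display) (T0 : measurableType d0).
Variables (P0 : probability T0 R) (A B : {RV P0 >-> R}).
Context (d : measure_display) (T : measurableType d) (P : probability T R).
Variables (A_ B_ : nat -> {RV P >-> R}) (D0 : {RV P >-> R}).
Hypotheses (A_ge0 : {ae P0, forall w, 0 <= A w}) (B_gt0 : {ae P0, forall w, 0 < B w}).
Hypothesis AB_law : forall (k : nat) (E : set (R * R)), measurable E ->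
  P [set w | E (A_ k w, B_ k w)] = P0 [set w | E (A w, B w)].
Hypothesis indep : mutually_independent P (driving_sigma A_ B_ D0).

Local Notation F := (driving_sigma A_ B_ D0).
Let AB k w := (A_ k w, B_ k w).

Let mAB k : measurable_fun setT (AB k). Proof. exact: measurable_fun_pair. Qed.

Let F_measurable i : F i `<=` measurable.
Proof.
case: i => [k|] _ [U mU <-]; rewrite setTI.
  exact: (measurable_funT_preimage (mAB k)).
exact: measurable_funT_preimage.
Qed.

Let F_AB k U : measurable U -> F (Some k) (AB k @^-1` U).
Proof. by move=> mU; exists U => //; rewrite setTI. Qed.

Let F_D0 U : measurable U -> F None (D0 @^-1` U).
Proof. by move=> mU; exists U => //; rewrite setTI. Qed.

Let affine (z : R * (R * R)) := z.2.1 * z.1 + z.2.2.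

Let measurable_affine : measurable_fun setT affine.
Proof.
apply: measurable_funD; last exact: measurableT_comp measurable_snd measurable_snd.
apply: measurable_funM; last exact: measurable_fst.
exact: measurableT_comp measurable_fst measurable_snd.
Qed.

Let input_AB (X : T -> R) k D : measurable_fun setT X ->
  independent_from P F X D -> D (Some k) -> affine_input A B P (A_ k) (B_ k) X.
Proof.
move=> mX XD Dk; split=> //; first exact: AB_law.
move=> U W mU mW.
exact: (independent_from_pair (@F_AB k) Dk XD mU mW).
Qed.

Let chain_spec (init : (T -> R) -> Prop) n : init D0 ->
  [/\ measurable_fun setT (chain A_ B_ D0 n),
      independent_from P F (chain A_ B_ D0 n)
        [set i | if i is Some k then (n <= k)%N else False] &
      affine_iter A B P init n (chain A_ B_ D0 n)].
Proof.
move=> iD0; elim: n => [|n [mX XD iX]].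
  split=> //; last exact: affine_iter0.
  exact: (independent_from_generator F_measurable indep F_D0).
split.
- by apply: measurable_funD => //; exact: measurable_funM.
- apply: (independent_from_comp F_measurable indep mX (mAB n) measurable_affine
    (@F_AB n) _ XD) => /=.
  + exact: leqnn.
  + by case=> [k|] //=; exact: ltnW.
  + by rewrite ltnn.
- by apply: (affine_iterS iX); apply: (input_AB mX XD) => /=.
Qed.

(** In reversed order only pairs with index at least j enter, so the outermost pair, the last to be
    applied, is still independent of the inner sum. *)
Let backward_spec n j : measurable_fun setT (backward A_ B_ n j) /\
  independent_from P F (backward A_ B_ n j)
    [set i | if i is Some k then (k < j)%N else False].
Proof.
elim: n j => [|n IH] j.
  by split; [exact: measurable_cst|exact: independent_from_cst].
have [mX XD] := IH j.+1; split.
  by apply: measurable_funD => //; exact: measurable_funM.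
apply: (independent_from_comp F_measurable indep mX (mAB j) measurable_affine
    (@F_AB j) _ XD) => /=.
- exact: ltnSn.
- by case=> [k|] //= kj; exact: ltnW.
- by rewrite ltnn.
Qed.

Let backward_iter0 n j : affine_iter A B P (fun X => X = fun=> 0) n (backward A_ B_ n j).
Proof.
elim: n j => [|n IH] j; first exact: affine_iter0.
have [mX XD] := backward_spec n j.+1.
by apply: (affine_iterS (IH j.+1)); apply: (input_AB mX XD) => /=.
Qed.

(** The lower bound needs positive starting variables, which 0 is not. The innermost map sends 0 to
    some B_k, so n + 1 maps from 0 count as n steps from B_k. *)
Let backward_iterB n j :
  affine_iter A B P (fun X => exists k, X = B_ k) n (backward A_ B_ n.+1 j).
Proof.
elim: n j => [|n IH] j.
  by apply: affine_iter0; exists j; apply/funext => w /=; rewrite mulr0 add0r.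
have [mX XD] := backward_spec n.+1 j.+1.
by apply: (affine_iterS (IH j.+1)); apply: (input_AB mX XD) => /=.
Qed.

Hypotheses (p0_gt0 : 0 < pmf A 0) (p0_lt1 : pmf A 0 < 1).

Local Notation h := (tail (distribution P0 (log1pD A B))).
Local Notation p0 := (pmf A 0).
Local Notation c := (affine_coef A).

Let ln_ge (M x : R) : expR M <= x -> 0 < x /\ M <= ln x.
Proof.
move=> Mx; have x0 : 0 < x by apply: lt_le_trans Mx; exact: expR_gt0.
by split=> //; rewrite -(expRK M) ler_ln ?posrE// expR_gt0.
Qed.

(** Take t = ln(1 + x), so that e^t - 1 = x, and use ln x <= ln(1 + x). *)
Let tail_le_ln (X : T -> R) (b M : R) x : 0 <= b ->
  (forall t, M <= t -> pr P [set w | expR t - 1 < X w] <= b * h t) ->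
  expR M <= x -> pr P [set w | x < X w] <= b * h (ln x).
Proof.
move=> b0 Xb /ln_ge[x0 Mx]; have x1 : 0 < 1 + x by rewrite addr_gt0.
have ln_le : ln x <= ln (1 + x) by rewrite ler_ln ?posrE// lerDr.
have := Xb (ln (1 + x)) (le_trans Mx ln_le).
rewrite lnK// addrAC subrr add0r => /le_trans; apply.
by apply: ler_wpM2l => //; exact: tail_anti.
Qed.

Lemma chain_tail_ge e : long_tailed (distribution P0 (log1pD A B)) ->
  {ae P, forall w, 0 < D0 w} -> 0 < e ->
  exists M, forall n x, M <= x ->
    (c n - e) * h (ln x) <= pr P [set w | x < chain A_ B_ D0 n w].
Proof.
move=> lH D0_gt0 e0.
have [|||M hM] := @affine_iter_tail_ge _ _ _ _ A B A_ge0 B_gt0 _ _ P p0_gt0 p0_lt1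
  (fun X => X = D0) _ _ e lH _ e0.
- by move=> _ ->.
- by move=> _ ->; apply: filterS D0_gt0 => w /ltW.
- have mD0 : measurable_fun setT D0 by [].
  move=> eta /(pr_gt0_approx P mD0)[k k01 D0k]; exists k => // _ ->.
  by rewrite -(pr_ae1 _ D0_gt0)//; exact: measurable_gtr.
exists M => n x Mx; apply: hM => //.
by have [] := @chain_spec (fun X => X = D0) n erefl.
Qed.

Lemma chain_tail_le e : subexponential (distribution P0 (log1pD A B)) ->
  {ae P, forall w, 0 < D0 w} ->
  (forall e, 0 < e -> exists M, forall t, M <= t -> pr P [set w | t < D0 w] <= e * h t) ->
  0 < e -> exists M, forall n x, M <= x ->
    pr P [set w | x < chain A_ B_ D0 n w] <= (c n + e) * h (ln x).
Proof.
move=> sH D0_gt0 D0_small e0.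
have [|||M hM] := @affine_iter_tail_le _ _ _ _ A B A_ge0 B_gt0 _ _ P p0_gt0 p0_lt1
  (fun X => X = D0) _ _ sH _ e e0.
- by move=> _ ->.
- by move=> _ ->; apply: filterS D0_gt0 => w /ltW.
- move=> eta /D0_small[M hM]; exists M => _ t -> /hM; apply: le_trans.
  (* The tail of D_0 is compared with h at the same point t, and e^t - 1 >= t. *)
  apply: pr_le; [exact: measurable_gtr|exact: measurable_gtr|].
  by move=> w /=; apply: le_lt_trans; rewrite lerBrDl expR_ge1Dx.
exists (expR M) => n x; apply: tail_le_ln.
  by rewrite addr_ge0 ?(ltW e0)// affine_coef_ge0.
move=> t; apply: hM.
by have [] := @chain_spec (fun X => X = D0) n erefl.
Qed.

Let coefs_nonneg :
  {ae P, forall w, (forall k, 0 <= A_ k w) /\ (forall k, 0 <= B_ k w)}.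
Proof.
(* The constant X = 0 is a dummy; the record serves to transfer the signs of A and B to the
   copies. *)
have inp k : affine_input A B P (A_ k) (B_ k) (fun=> 0).
  apply: (input_AB _ (D := setT)) => //; exact: independent_from_cst.
have : {ae P, forall w, forall k, 0 <= A_ k w /\ 0 <= B_ k w}.
  apply/ae_foralln => k; have := input_gt0 B_gt0 (inp k).
  by have := input_ge0 A_ge0 (inp k); apply: filterS2 => w Aw /ltW.
by apply: filterS => w AB0; split=> k; case: (AB0 k).
Qed.

Let pr_perpetuity x : pr P [set w | (x%:E < perpetuity A_ B_ w)%E] =
  pr P (\bigcup_n [set w | x < backward A_ B_ n 0 w]).
Proof.
apply: pr_ae_eq.
- rewrite (_ : perpetuity _ _ = fun w => limn (fun n => (backward A_ B_ n 0 w)%:E)).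
    apply: measurable_limn_gt => n; apply/measurable_EFinP.
    by case: (backward_spec n 0).
  by apply/funext => w; rewrite perpetuityE.
- apply: bigcup_measurable => n _; apply: measurable_gtr => //.
  by case: (backward_spec n 0).
apply: filterS coefs_nonneg => w [Aw Bw] /=; rewrite perpetuity_gt//.
by split=> [[n]|[n _]]; exists n.
Qed.

(** A single partial sum suffices: fix n with c_n >= 1/p0 - e/2 and spend the other e/2 on its tail
    bound. *)
Lemma perpetuity_tail_ge e : long_tailed (distribution P0 (log1pD A B)) ->
  0 < e -> exists M, forall x, M <= x ->
    (p0^-1 - e) * h (ln x) <= pr P [set w | (x%:E < perpetuity A_ B_ w)%E].
Proof.
move=> lH e0; have e20 : 0 < e / 2 by rewrite divr_gt0.
have mB : measurable_fun setT B by [].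
have B_law k x : pr P [set w | x < B_ k w] = pr P0 [set w | x < B w].
  have mx : measurable [set z : R * R | x < z.2].
    by apply: measurable_gtr => //; exact: measurable_snd.
  by rewrite /pr (AB_law k mx).
have [|||M hM] := @affine_iter_tail_ge _ _ _ _ A B A_ge0 B_gt0 _ _ P p0_gt0 p0_lt1
  (fun X => exists k, X = B_ k) _ _ (e / 2) lH _ e20.
- by move=> _ [k ->].
- by move=> _ [k ->]; apply: filterS coefs_nonneg => w [].
- move=> eta /(pr_gt0_approx P0 mB)[k k01 Bk]; exists k => // _ [j ->].
  by rewrite B_law -(pr_ae1 _ B_gt0)//; exact: measurable_gtr.
have [n cn] := affine_coef_approx p0_gt0 p0_lt1 e20.
exists M => x Mx; rewrite pr_perpetuity.
apply: (@le_trans _ _ ((c n - e / 2) * h (ln x))).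
  by apply: ler_wpM2r; [exact: tail_ge0|lra].
apply: le_trans (hM _ _ _ (backward_iterB n 0) Mx) _; apply: pr_le.
- by apply: measurable_gtr => //; case: (backward_spec n.+1 0).
- apply: bigcup_measurable => k _; apply: measurable_gtr => //.
  by case: (backward_spec k 0).
- by move=> w xw; exists n.+1.
Qed.

(** The threshold M is common to all partial sums and c_n <= 1/p0, so the bound survives their
    monotone limit. The start at 0 has an empty tail event for t >= 0. *)
Lemma perpetuity_tail_le e : subexponential (distribution P0 (log1pD A B)) ->
  0 < e -> exists M, forall x, M <= x ->
    pr P [set w | (x%:E < perpetuity A_ B_ w)%E] <= (p0^-1 + e) * h (ln x).
Proof.
move=> sH e0.
have [|||M hM] := @affine_iter_tail_le _ _ _ _ A B A_ge0 B_gt0 _ _ P p0_gt0 p0_lt1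
  (fun X => X = fun=> 0) _ _ sH _ e e0.
- by move=> _ ->; exact: measurable_cst.
- by move=> _ ->; exact: aeW.
- move=> eta eta0; exists 0 => _ t -> t0.
  rewrite (_ : [set _ | _] = set0); last first.
    by apply/seteqP; split=> w //=; rewrite ltNge subr_ge0 -expR0 ler_expR t0.
  by rewrite /pr measure0 mulr_ge0 ?tail_ge0// ltW.
have pe0 : 0 <= p0^-1 + e by rewrite addr_ge0 ?(ltW e0)// invr_ge0 ltW.
exists (expR M) => x Mx; rewrite pr_perpetuity; apply: pr_bigcup_le.
- by move=> n; apply: measurable_gtr => //; case: (backward_spec n 0).
- move=> n; apply: filterS coefs_nonneg => w [Aw Bw].
  have /= bS := @backward_nondecreasing _ _ _ A_ B_ w Aw Bw _ _ (leqnSn n).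
  by move=> /= /lt_le_trans; exact.
move=> n; apply: tail_le_ln Mx => // t Mt.
apply: (le_trans (hM _ _ _ (backward_iter0 n 0) Mt)).
by apply: ler_wpM2r; [exact: tail_ge0|rewrite lerD2r affine_coef_le].
Qed.

End driven_recursion.

(** * From two-sided bounds to asymptotic equivalence *)

Unset Implicit Arguments.
Set Strict Implicit.
Set Printing Implicit Defensive.

Theorem theorem5
    (R : realType)
    (d0 : measure_display) (T0 : measurableType d0) (P0 : probability T0 R)
    (A B : {RV P0 >-> R})
    (d : measure_display) (T : measurableType d) (P : probability T R)
    (A_ B_ : nat -> {RV P >-> R}) (D0 : {RV P >-> R})
    (A_ge0 : {ae P0, forall w, 0 <= A w})
    (B_gt0 : {ae P0, forall w, 0 < B w})
    (p0_gt0 : 0 < pmf A 0) (p0_lt1 : pmf A 0 < 1)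
    (logA_mean : negative_log_mean P0 A)
    (AB_law : forall (k : nat) (E : set (R * R)), measurable E ->
      P [set w | E (A_ k w, B_ k w)] = P0 [set w | E (A w, B w)])
    (indep : mutually_independent P (driving_sigma A_ B_ D0)) :
  let p0 := pmf A 0 in
  let H := distribution P0 (log1pD A B) in
  let c := fun n : nat => (1 - (1 - p0) ^+ n) / p0 in
  let PD := fun (n : nat) (x : R) => fine (P [set w | x < chain A_ B_ D0 n w]) in
  let PDoo := fun x : R => fine (P [set w | (x%:E < perpetuity A_ B_ w)%E]) in
  (long_tailed H -> {ae P, forall w, 0 < D0 w} ->
     (forall e : R, 0 < e -> \forall x \near +oo,
        forall n : nat, (1 <= n)%N -> (c n - e) * tail H (ln x) <= PD n x) /\
     (forall e : R, 0 < e -> \forall x \near +oo,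
        (p0^-1 - e) * tail H (ln x) <= PDoo x)) /\
  (subexponential H -> {ae P, forall w, 0 < D0 w} ->
     PD 0%N x / tail H x @[x --> +oo] --> (0 : R) ->
     (forall e : R, 0 < e -> \forall x \near +oo,
        forall n : nat, (1 <= n)%N ->
          `|PD n x / (c n * tail H (ln x)) - 1| <= e) /\
     PDoo x / (p0^-1 * tail H (ln x)) @[x --> +oo] --> (1 : R)).
Proof.
move=> p0 H c PD PDoo.
have ge_chain lH D0_gt0 e (e0 : 0 < e) := chain_tail_ge A_ge0 B_gt0 AB_law indep
  p0_gt0 p0_lt1 lH D0_gt0 e0.
have ge_perp lH e (e0 : 0 < e) := perpetuity_tail_ge A_ge0 B_gt0 AB_law indep
  p0_gt0 p0_lt1 lH e0.
split=> [lH D0_gt0|sH D0_gt0 D0_small].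
  split=> e e0; apply/near_pinftyP.
    by have [M hM] := ge_chain lH D0_gt0 e e0; exists M => x Mx n _; exact: hM.
  by have [M hM] := ge_perp lH e e0; exists M.
have lH := subexponential_long_tailed sH.
have h_gt0 t : 0 < tail H t by case: sH.
have {}D0_small e : 0 < e ->
    exists M, forall t, M <= t -> pr P [set w | t < D0 w] <= e * tail H t.
  move/cvgr_pinfty_dist : D0_small => /[apply] -[M hM]; exists M => t /hM.
  rewrite subr0 ger0_norm; last by rewrite divr_ge0 ?(ltW (h_gt0 t))// pr_ge0.
  by rewrite ler_pdivrMr.
(* The errors so far are additive in the coefficient; a >= 1 makes them relative errors of at most
   e. For a = c_n this is where n >= 1 enters. *)
have close (a e u v : R) : 1 <= a -> 0 < e -> 0 < v ->
    (a - e) * v <= u -> u <= (a + e) * v -> `|u / (a * v) - 1| <= e.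
  move=> a1 e0 v0 lo hi; have av0 : 0 < a * v by rewrite mulr_gt0// (lt_le_trans _ a1).
  rewrite ler_distl ler_pdivlMr// ler_pdivrMr//.
  have : 0 <= (a - 1) * (e * v) by rewrite mulr_ge0 ?subr_ge0// mulr_ge0// ltW.
  by move=> aev; apply/andP; split; lra.
split=> [e e0|].
  have [M1 hM1] := ge_chain lH D0_gt0 e e0.
  have [M2 hM2] := chain_tail_le A_ge0 B_gt0 AB_law indep p0_gt0 p0_lt1
    sH D0_gt0 D0_small e0.
  apply/near_pinftyP; exists (Num.max M1 M2) => x; rewrite ge_max => /andP[M1x M2x].
  case=> [//|n] _; apply: close => //.
  - exact: affine_coef_ge1.
  - exact: hM1.
  - exact: hM2.
apply/cvgr_pinfty_dist => e e0.
have [M1 hM1] := ge_perp lH e e0.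
have [M2 hM2] := perpetuity_tail_le A_ge0 B_gt0 AB_law indep p0_gt0 p0_lt1 sH e0.
exists (Num.max M1 M2) => x; rewrite ge_max => /andP[M1x M2x].
apply: close => //; first by rewrite invf_ge1// ltW.
  exact: hM1.
exact: hM2.
Qed.
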